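(* Let $X$ be a Banach space with a conditional spreading basis $(e_i)_i$ and let $(z_i)_i$ be the convex block homogeneous part of $(e_i)_i$. The following hold. (i) There exists a block sequence $(\tilde z_i)_i$ of averages of the basis $(e_i)_i$ that is equivalent to $(z_i)_i$. (ii) The closed linear span of every convex block sequence $(x_i)_i$ of the basis $(e_i)_i$ that is equivalent to $(z_i)_i$ is complemented in $X$. In particular, $Z=[(z_i)_i]$ is isomorphic to a complemented subspace of $X$. (iii) Every convex block sequence $(x_i)_i$ of the basis $(e_i)_i$ has a subsequence that is equivalent either to $(e_i)_i$ or to $(z_i)_i$. (iv) Every convex block sequence $(x_i)_i$ of the basis $(e_i)_i$ has a further convex block sequence that is equivalent to $(z_i)_i$. (v) Every seminormalized block sequence $(x_i)_i$ of the basis $(e_i)_i$ either has a subsequence that is unconditional or it has a convex block sequence that is equivalent to $(z_i)_i$.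
   Context: Banach spaces are real; $[(z_i)_i]$ denotes closed linear span. Two sequences are equivalent if the norms of their finite linear combinations with the same coefficients are comparable up to uniform positive constants. A sequence is spreading (resp. 1-spreading) if it is equivalent (resp. isometrically equivalent) to all of its subsequences. A conditional spreading basis is a Schauder basis that is spreading and not unconditional. A convex block sequence of $(x_i)_i$ is a sequence $(w_k)_k$ with $w_k=\sum_{i\in F_k}c_ix_i$, where $F_1<F_2<\cdots$ are successive finite subsets of $\mathbb{N}$, $c_i\geqslant0$ and $\sum_{i\in F_k}c_i=1$; it is a block sequence of averages if $c_i=1/\#F_k$ for all $i\in F_k$ and all $k$. Convex block homogeneous part: let $(e_i)_i$ be a conditional spreading basis of $X$. After passing to an equivalent norm on $X$ with respect to which $(e_i)_i$ is 1-spreading (such a norm exists), let $Z$ be the completion of $c_{00}(\mathbb{N})$, with unit vector basis denoted $(z_i)_i$, under the norm $$\Big\|\sum_{i=1}^na_iz_i\Big\|=\lim_{N\to\infty}\Big\|\sum_{i=1}^na_i\Big(\frac1N\sum_{j=(i-1)N+1}^{iN}e_j\Big)\Big\|=\inf\Big\{\Big\|\sum_{i=1}^na_iw_i\Big\|:(w_i)_{i=1}^n\text{ is a convex block sequence of }(e_i)_i\Big\}.$$ The sequence $(z_i)_i$, which is well defined up to equivalence, is the convex block homogeneous part of $(e_i)_i$. *)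

(* Defs.v *)
From HB Require Import structures.
From mathcomp Require Import all_boot all_order all_algebra finmap.
From mathcomp Require Import all_classical all_reals all_analysis.

Set Implicit Arguments.
Unset Strict Implicit.
Unset Printing Implicit Defensive.

Import Order.TTheory GRing.Theory Num.Theory.
Import numFieldNormedType.Exports.

Local Open Scope classical_set_scope.
Local Open Scope ring_scope.

(* Sequences are indexed from 0: the term written x_i, i >= 1, on paper is
   [x i.-1]. *)

Definition lincomb (R : realType) (V : lmodType R)
    (x : nat -> V) (n : nat) (a : nat -> R) : V :=
  \sum_(i < n) a i *: x i.

Definition equivalent_seq (R : realType) (V W : normedModType R)
    (x : nat -> V) (y : nat -> W) : Prop :=
  exists c C : R, [/\ 0 < c, 0 < C &
    forall (n : nat) (a : nat -> R),
      c * `|lincomb x n a| <= `|lincomb y n a| <= C * `|lincomb x n a|].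

Definition closed_span (R : realType) (V : normedModType R) (x : nat -> V) :
    set V :=
  closure [set v | exists (n : nat) (a : nat -> R), v = lincomb x n a].

Definition is_expansion (R : realType) (V : normedModType R)
    (x : nat -> V) (a : nat -> R) (v : V) : Prop :=
  series (fun i => a i *: x i) @ \oo --> v.

(* [x] is a Schauder basis of the closed subspace [S] of [V]. *)
Definition schauder_basis_of (R : realType) (V : normedModType R)
    (S : set V) (x : nat -> V) : Prop :=
  (forall i, S (x i)) /\
  (forall v, S v -> exists! a : nat -> R, is_expansion x a v).

Definition schauder_basis (R : realType) (V : normedModType R)
    (x : nat -> V) : Prop := schauder_basis_of setT x.

(* A sequence is unconditional if it is a Schauder basis of its closed linear
   span for which all expansions converge unconditionally, that is, after any
   rearrangement of their terms. *)
Definition unconditional_seq (R : realType) (V : normedModType R)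
    (x : nat -> V) : Prop :=
  schauder_basis_of (closed_span x) x /\
  forall (a : nat -> R) (v : V), is_expansion x a v ->
    forall s : nat -> nat, bijective s ->
      cvgn (series (fun i => a (s i) *: x (s i))).

Definition spreading (R : realType) (V : normedModType R) (x : nat -> V) :
    Prop :=
  forall f : nat -> nat, increasing_seq f -> equivalent_seq x (x \o f).

Definition conditional_spreading_basis (R : realType) (V : normedModType R)
    (e : nat -> V) : Prop :=
  [/\ schauder_basis e, spreading e & ~ unconditional_seq e].

Definition successive (F : nat -> {fset nat}) : Prop :=
  forall k l, (k < l)%N ->
    forall i j, i \in F k -> j \in F l -> (i < j)%N.

Definition is_block_of (R : realType) (V : lmodType R)
    (x : nat -> V) (F : nat -> {fset nat}) (c : nat -> R) (w : nat -> V) :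
    Prop :=
  successive F /\ forall k, w k = \sum_(i <- F k) c i *: x i.

Definition block_seq (R : realType) (V : lmodType R) (x w : nat -> V) : Prop :=
  exists (F : nat -> {fset nat}) (c : nat -> R), is_block_of x F c w.

Definition is_convex_block_of (R : realType) (V : lmodType R)
    (x : nat -> V) (F : nat -> {fset nat}) (c : nat -> R) (w : nat -> V) :
    Prop :=
  [/\ is_block_of x F c w,
      forall k i, i \in F k -> 0 <= c i &
      forall k, \sum_(i <- F k) c i = 1].

Definition convex_block_seq (R : realType) (V : lmodType R)
    (x w : nat -> V) : Prop :=
  exists (F : nat -> {fset nat}) (c : nat -> R), is_convex_block_of x F c w.

Definition averages_block_seq (R : realType) (V : lmodType R)
    (x w : nat -> V) : Prop :=
  exists (F : nat -> {fset nat}) (c : nat -> R),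
    is_convex_block_of x F c w /\
    forall k i, i \in F k -> c i = (#|` F k|%fset%:R)^-1.

Definition seminormalized (R : realType) (V : normedModType R)
    (x : nat -> V) : Prop :=
  exists m M : R, 0 < m /\ forall k, m <= `|x k| <= M.

Definition is_norm (R : realType) (V : lmodType R) (nu : V -> R) : Prop :=
  [/\ forall u v, nu (u + v) <= nu u + nu v,
      forall (a : R) v, nu (a *: v) = `|a| * nu v &
      forall v, nu v = 0 -> v = 0].

Definition equivalent_norm (R : realType) (V : normedModType R)
    (nu : V -> R) : Prop :=
  is_norm nu /\
  exists c C : R, [/\ 0 < c, 0 < C &
    forall v, c * `|v| <= nu v <= C * `|v|].

Definition one_spreading (R : realType) (V : lmodType R)
    (nu : V -> R) (x : nat -> V) : Prop :=
  forall f : nat -> nat, increasing_seq f ->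
    forall (n : nat) (a : nat -> R),
      nu (lincomb (x \o f) n a) = nu (lincomb x n a).

(* The [i]-th of the averages of [e] over consecutive intervals of length [N];
   it is meaningful for [N] positive only. *)
Definition interval_average (R : realType) (V : lmodType R)
    (e : nat -> V) (N i : nat) : V :=
  N%:R^-1 *: \sum_(i * N <= j < i.+1 * N) e j.

(* The completion of c_00 under a norm is presented, as it may be up to isometric
   isomorphism, as a Banach space [Z] with a sequence [z] of dense linear span,
   the image of the unit vector basis; the norm on c_00 is then
   [fun a => `|lincomb z n a|], for [a] supported by the first [n] integers.
   The infimum ranges over infinite convex block sequences, of which
   [lincomb w n a] only sees the first [n] terms: every finite convex block
   sequence extends to an infinite one. *)
Definition convex_block_homogeneous_part (R : realType)
    (X Z : completeNormedModType R) (e : nat -> X) (z : nat -> Z) : Prop :=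
  closed_span z = setT /\
  exists nu : X -> R,
    [/\ equivalent_norm nu,
        one_spreading nu e,
        forall (n : nat) (a : nat -> R),
          (fun N => nu (lincomb (interval_average e N) n a)) @ \oo
            --> (`|lincomb z n a| : R) &
        forall (n : nat) (a : nat -> R),
          `|lincomb z n a| =
            inf [set nu (lincomb w n a) | w in convex_block_seq e]].

Definition complemented (R : realType) (V : normedModType R) (Y : set V) :
    Prop :=
  exists P : {linear V -> V},
    [/\ continuous P, forall v, P (P v) = P v & range P = Y].

Definition isomorphic_to_subspace (R : realType) (W V : normedModType R)
    (Y : set V) : Prop :=
  exists (T : {linear W -> V}) (S : V -> W),
    [/\ continuous T, range T = Y, cancel T S & {within Y, continuous S}].

(* Main.v *)
(* Let nu be the 1-spreading norm and d_i = e_(2i) - e_(2i+1); write E, D and Z for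
   the seminorms that the sequences e (under nu), d (under nu) and z induce on
   c_00.  Averaging over shifts, which does not change nu, yields:
   - adding up coordinates along a nondecreasing map of the indices does not
     increase Z, and Z <= E;
   - d is unconditional, since a difference of consecutive vectors averages out;
   - D / 2 <= E <= D + Z.
   As e is conditional, the averages of d tend to 0 (otherwise e would be
   equivalent to the basis of l_1) and z_0 <> 0; as it is a Schauder basis,
   z_0 <> z_1, and so the coordinates are bounded with respect to Z.

   On a convex block sequence Z is unchanged, so such a sequence is equivalent
   to z as soon as its D-norms decrease fast, which taking long averages
   achieves; if instead the D-norms stay away from 0, so do the largest
   coefficients of the blocks, and the sequence is equivalent to e.  The map
   e_i |-> x_k, for i in the k-th of consecutive intervals containing the
   supports of the x_k, is a projection, bounded by the first item.

   For signed blocks x_k, let s_k be the sum of the coefficients of x_k,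
   convergent to s after passing to a subsequence, and add to the D-norm of
   sum a_k x_k the Z-norm of sum a_k (x_k - s_k e_(n_k)): this defines an
   unconditional norm H dominated by the original one.  If s = 0, the two are
   equivalent along a subsequence.  If s <> 0, either H is bounded below on convex
   combinations, and then (x_k) is equivalent to the basis of l_1, or convex
   combinations with fast decreasing H-norms are equivalent to z. *)
Require Import Defs.
From HB Require Import structures.
From mathcomp Require Import all_boot all_order all_algebra finmap.
From mathcomp Require Import all_classical all_reals all_analysis.
From mathcomp Require Import zify ring lra.

Set Implicit Arguments.
Unset Strict Implicit.
Unset Printing Implicit Defensive.

Import Order.TTheory GRing.Theory Num.Theory.
Import numFieldNormedType.Exports.

Local Open Scope classical_set_scope.
Local Open Scope ring_scope.

(* [{poly R}] serves as c_00(N): ['X^i] is the i-th unit vector, and [lin y] is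
   the linear map sending it to [y i]. *)
Definition lin (R : realType) (V : lmodType R) (y : nat -> V) (p : {poly R}) : V :=
  \sum_(i < size p) p`_i *: y i.

(** * Finitely supported sequences as polynomials *)

Section Lin.
Variable R : realType.
Implicit Types (V W : lmodType R) (p q : {poly R}).

Lemma linE V (y : nat -> V) p m : (size p <= m)%N ->
  lin y p = \sum_(i < m) p`_i *: y i.
Proof.
move=> pm; rewrite /lin (big_ord_widen_cond m xpredT (fun i => p`_i *: y i)) //.
rewrite big_mkcond; apply: eq_bigr => i _ /=; case: ltnP => // si.
by rewrite nth_default // scale0r.
Qed.

Lemma lin_is_linear V (y : nat -> V) : linear (lin y).
Proof.
move=> a p q; pose m := maxn (size p) (size q).
have hp : (size p <= m)%N by exact: leq_maxl.
have hq : (size q <= m)%N by exact: leq_maxr.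
have hs : (size (a *: p + q)%R <= m)%N.
  apply: leq_trans (size_polyD _ _) _; rewrite geq_max hq andbT.
  exact: leq_trans (size_scale_leq _ _) hp.
rewrite (linE y hs) (linE y hp) (linE y hq) scaler_sumr -big_split /=.
by apply: eq_bigr => i _; rewrite coefD coefZ scalerDl scalerA.
Qed.

HB.instance Definition _ V (y : nat -> V) :=
  GRing.isLinear.Build R {poly R} V *:%R (lin y) (lin_is_linear y).

Lemma eq_lin V (y y' : nat -> V) p :
  (forall i, p`_i != 0 -> y i = y' i) -> lin y p = lin y' p.
Proof.
move=> h; apply: eq_bigr => i _.
by have [->|/h ->//] := eqVneq p`_i 0; rewrite !scale0r.
Qed.

Lemma lin_comp V W (phi : {linear V -> W}) (y : nat -> V) p :
  phi (lin y p) = lin (phi \o y) p.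
Proof. by rewrite /lin linear_sum; apply: eq_bigr => i _; rewrite linearZ. Qed.

Lemma linX V (y : nat -> V) i : lin y 'X^i = y i.
Proof.
rewrite /lin size_polyXn big_ord_recr /= coefXn eqxx scale1r big1 ?add0r // => j _.
by rewrite coefXn ltn_eqF ?ltn_ord // scale0r.
Qed.

Lemma linC V (y : nat -> V) : lin y 1 = y 0%N.
Proof. by rewrite -(linX y) expr0. Qed.

Lemma lin_poly V (y : nat -> V) n a : lin y (\poly_(i < n) a i) = lincomb y n a.
Proof.
rewrite (linE y (size_poly _ _)); apply: eq_bigr => i _.
by rewrite coef_poly ltn_ord.
Qed.

Lemma lin_id p : lin (fun i => 'X^i) p = p.
Proof. by rewrite /lin -[RHS]coefK poly_def. Qed.

Lemma linDl V (y y' : nat -> V) p : lin (fun i => y i + y' i) p = lin y p + lin y' p.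
Proof. by rewrite /lin -big_split; apply: eq_bigr => i _; rewrite scalerDr. Qed.

Lemma linBl V (y y' : nat -> V) p : lin (fun i => y i - y' i) p = lin y p - lin y' p.
Proof. by rewrite /lin -sumrB; apply: eq_bigr => i _; rewrite scalerBr. Qed.

Lemma linZl V (y : nat -> V) (a : R) p : lin (fun i => a *: y i) p = a *: lin y p.
Proof.
by rewrite /lin scaler_sumr; apply: eq_bigr => i _; rewrite !scalerA mulrC.
Qed.

Lemma lin_suml V n (y : nat -> nat -> V) p :
  lin (fun i => \sum_(t < n) y t i) p = \sum_(t < n) lin (y t) p.
Proof. by rewrite /lin exchange_big; apply: eq_bigr => i _; rewrite scaler_sumr. Qed.

(** Lets [p.[1]] stand for the mass of a finitely supported vector, so that the evaluation lemmas
    apply to it. *)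
Lemma horner1_lin p : p.[1] = \sum_(i < size p) p`_i.
Proof. by rewrite horner_coef; apply: eq_bigr => i _; rewrite expr1n mulr1. Qed.

Lemma horner1E p m : (size p <= m)%N -> p.[1] = \sum_(i < m) p`_i.
Proof.
by move=> pm; rewrite (horner_coef_wide _ pm); apply: eq_bigr => i _; rewrite expr1n mulr1.
Qed.

Lemma lin_const V (v : V) p : lin (fun=> v) p = p.[1] *: v.
Proof. by rewrite horner1_lin scaler_suml. Qed.

Lemma coef_lin (y : nat -> {poly R}) p i :
  (lin y p)`_i = \sum_(k < size p) p`_k * (y k)`_i.
Proof. by rewrite coef_sum; apply: eq_bigr => k _; rewrite coefZ. Qed.

Lemma horner_lin (y : nat -> {poly R}) p x :
  (lin y p).[x] = \sum_(k < size p) p`_k * (y k).[x].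
Proof. by rewrite horner_sum; apply: eq_bigr => k _; rewrite hornerZ. Qed.

(* Coordinates with the same image under [k] are added up. *)
Definition collapse (k : nat -> nat) : {poly R} -> {poly R} := lin (fun i => 'X^(k i)).
(** A diagonal multiplier; when [th] takes the values 0 and 1 it is a coordinate projection. *)
Definition coefmul (th : nat -> R) : {poly R} -> {poly R} :=
  lin (fun i => th i *: 'X^i).

HB.instance Definition _ k := GRing.Linear.copy (collapse k) (lin (fun i => 'X^(k i))).
HB.instance Definition _ th := GRing.Linear.copy (coefmul th) (lin (fun i => th i *: 'X^i)).

Lemma lin_collapse V (y : nat -> V) k p : lin y (collapse k p) = lin (y \o k) p.
Proof. by rewrite /collapse lin_comp; apply: eq_lin => i _ /=; rewrite linX. Qed.

Lemma lin_coefmul V (y : nat -> V) th p : lin y (coefmul th p) = lin (fun i => th i *: y i) p.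
Proof. by rewrite /coefmul lin_comp; apply: eq_lin => i _ /=; rewrite linearZ /= linX. Qed.

Lemma coef_coefmul th p i : (coefmul th p)`_i = th i * p`_i.
Proof.
rewrite coef_lin; have [si|si] := ltnP i (size p).
  rewrite (bigD1 (Ordinal si)) //= coefZ coefXn eqxx mulr1 big1 ?addr0 1?mulrC //.
  move=> j ji; rewrite coefZ coefXn; case: eqVneq => [ij|_]; last by rewrite !mulr0.
  by case/negP: ji; apply/eqP/val_inj.
rewrite (nth_default _ si) mulr0 big1 // => j _.
by rewrite coefZ coefXn gtn_eqF ?mulr0 // (leq_trans (ltn_ord j)).
Qed.

Lemma collapse_X k i : collapse k 'X^i = 'X^(k i). Proof. exact: linX. Qed.

Lemma collapse_horner1 k p : (collapse k p).[1] = p.[1].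
Proof.
rewrite horner_lin horner1_lin; apply: eq_bigr => i _.
by rewrite hornerXn expr1n mulr1.
Qed.

End Lin.

(** * Seminorms and averages of vectors *)

Section Seminorm.
Variables (R : realType).
Implicit Types (V : lmodType R).

Definition seminorm V (N : V -> R) :=
  (forall u v, N (u + v) <= N u + N v) /\ (forall a v, N (a *: v) = `|a| * N v).

Section Thy.
Variables (V : lmodType R) (N : V -> R) (HN : seminorm N).

Lemma sn_tri u v : N (u + v) <= N u + N v. Proof. exact: HN.1. Qed.
Lemma snZ a v : N (a *: v) = `|a| * N v. Proof. exact: HN.2. Qed.
Lemma sn0 : N 0 = 0. Proof. by rewrite -(scale0r 0) snZ normr0 mul0r. Qed.
Lemma snN v : N (- v) = N v.
Proof. by rewrite -scaleN1r snZ normrN1 mul1r. Qed.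
Lemma sn_triB u v : N (u - v) <= N u + N v.
Proof. by rewrite -(snN v) sn_tri. Qed.
Lemma sn_ge0 v : 0 <= N v.
Proof. by have := sn_triB v v; rewrite subrr sn0; lra. Qed.
Lemma sn_ler_sub u v : N u <= N v + N (u - v).
Proof. by rewrite -{1}(subrK v u) addrC; exact: sn_tri. Qed.
Lemma sn_sum (I : Type) (r : seq I) (P : pred I) (F : I -> V) :
  N (\sum_(i <- r | P i) F i) <= \sum_(i <- r | P i) N (F i).
Proof.
elim/big_rec2: _ => [|i y x _ h]; first by rewrite sn0.
by apply: le_trans (sn_tri _ _) _; rewrite lerD2l.
Qed.
Lemma sn_lin (y : nat -> V) p : N (lin y p) <= \sum_(i < size p) `|p`_i| * N (y i).
Proof.
by apply: le_trans (sn_sum _ _ _) _; apply: ler_sum => i _; rewrite snZ.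
Qed.
Lemma sn_convex (I : Type) (r : seq I) (c : I -> R) (F : I -> V) B :
  (forall i, 0 <= c i) -> \sum_(i <- r) c i = 1 -> (forall i, c i != 0 -> N (F i) <= B) ->
  N (\sum_(i <- r) c i *: F i) <= B.
Proof.
move=> c0 c1 h; apply: le_trans (sn_sum _ _ _) _.
rewrite -[B]mul1r -c1 mulr_suml; apply: ler_sum => i _.
rewrite snZ ger0_norm //; have [->|/h] := eqVneq (c i) 0; first by rewrite !mul0r.
exact: ler_wpM2l.
Qed.
Lemma sn_average M (F : nat -> V) B : (forall t, (t < M)%N -> N (F t) <= B) ->
  N (\sum_(t < M) F t) <= M%:R * B.
Proof.
move=> h; apply: le_trans (sn_sum _ _ _) _.
apply: le_trans (_ : \sum_(t < M) B <= _).
  by apply: ler_sum => t _; exact: h.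
by rewrite sumr_const card_ord -[in leLHS]mulr_natl.
Qed.
(* The two windows of length [M] differ by at most [2 * i] terms, however large
   [M] is. *)
Lemma sn_shift (y : nat -> V) B q i M : (forall j, N (y j) <= B) ->
  N (\sum_(t < M) y (q + i + t)%N - \sum_(t < M) y (q + t)%N) <= (2 * i)%:R * B.
Proof.
move=> hB; elim: i => [|i IH].
  by rewrite addn0 subrr sn0 mul0r.
have -> : \sum_(t < M) y (q + i.+1 + t)%N = \sum_(t < M) y (q + i + t)%N
    + (y (q + i + M)%N - y (q + i)%N).
  apply/eqP; rewrite addrA eq_sym subr_eq; apply/eqP.
  rewrite -(big_ord_recr M (fun t => y (q + i + t)%N)) big_ord_recl addn0.
  rewrite [RHS]addrC.
  congr (_ + _); apply: eq_bigr => t _; congr y; rewrite /= /bump /=; lia.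
rewrite addrAC; apply: le_trans (sn_tri _ _) _.
apply: le_trans (lerD IH (sn_triB _ _)) _.
have h1 := hB (q + i + M)%N; have h2 := hB (q + i)%N.
by rewrite mulnS natrD mulrDl; lra.
Qed.
End Thy.

Lemma seminorm_comp V (W : lmodType R) (N : V -> R) (phi : {linear W -> V}) :
  seminorm N -> seminorm (N \o phi).
Proof.
move=> HN; split=> [u v|a v] /=; first by rewrite linearD (sn_tri HN).
by rewrite linearZ (snZ HN).
Qed.

Lemma seminorm_norm (V : normedModType R) : seminorm (fun v : V => `|v|).
Proof. by split=> [u v|a v]; [exact: ler_normD|exact: normrZ]. Qed.

End Seminorm.

(** * Monotone maps of the indices *)

Definition nondec (k : nat -> nat) := forall i j, (i <= j)%N -> (k i <= k j)%N.

Lemma incr_lt f : (forall i, (f i < f i.+1)%N) -> forall i j, (i < j)%N -> (f i < f j)%N.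
Proof. by move=> h; exact: (homo_ltn ltn_trans h). Qed.

Lemma incr_le f : (forall i, (f i < f i.+1)%N) -> forall i j, (i <= j)%N -> (f i <= f j)%N.
Proof.
by move=> h i j; rewrite leq_eqVlt => /predU1P[->//|/(incr_lt h)/ltnW].
Qed.

Lemma incr_ge f : (forall i, (f i < f i.+1)%N) -> forall i, (i <= f i)%N.
Proof. by move=> h; elim=> // i IH; exact: leq_ltn_trans (h i). Qed.

(** * Inequalities up to an error O(1/N) *)

Section Limits.
Variable R : realType.

Lemma ler_addinv (a b K : R) :
  (forall N, (0 < N)%N -> a <= b + K / N%:R) -> a <= b.
Proof.
move=> h; rewrite leNgt; apply/negP => ba.
have K0 : 0 < K.
  rewrite ltNge; apply/negP => K0; have := h 1%N isT; rewrite divr1; lra.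
pose N := Num.truncn (K / (a - b)); have := h N.+1 isT.
apply/negP; rewrite -ltNge -ltrBrDl ltr_pdivrMr // -ltr_pdivrMl ?subr_gt0 // mulrC.
exact: truncnS_gt.
Qed.

(** Index 0 is left out because interval averages of length 0 are meaningless. *)
Lemma le_cvgn (a l : R) (u : nat -> R) :
  (forall N, (0 < N)%N -> a <= u N) -> u @ \oo --> l -> a <= l.
Proof.
move=> h hu; rewrite -(cvg_lim _ hu) //; apply: limr_ge; first by apply/cvg_ex; exists l.
by exists 1%N => // n /= hn; exact: h.
Qed.

Lemma cvgn_le_addinv (b K l : R) (u : nat -> R) :
  (forall N, (0 < N)%N -> u N <= b + K / N%:R) -> u @ \oo --> l -> l <= b.
Proof.
move=> h hu; apply/ler_addgt0Pl => eps eps0.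
have [K0|K0] := leP K 0.
  rewrite -lerN2; apply: (@le_cvgn _ _ (- u)); last exact: cvgN.
  move=> N N0; rewrite /= lerN2; apply: le_trans (h N N0) _.
  have : K / N%:R <= 0 by rewrite mulr_le0_ge0 // invr_ge0.
  lra.
(* From index [M] on the error [K / N] is below [eps]; shifting the sequence by [M] leaves its limit
   unchanged. *)
pose M := (Num.truncn (K / eps)).+1.
rewrite -lerN2; apply: (@le_cvgn _ _ (fun N => - u (M + N)%N)); last first.
  by apply: cvgN; rewrite -(cvg_shiftn M) in hu; under eq_fun do rewrite addnC.
move=> N N0; rewrite lerN2; apply: le_trans (h (M + N)%N _) _; first by rewrite addn_gt0 N0 orbT.
rewrite addrC lerD2r ler_pdivrMr; last by rewrite ltr0n addn_gt0 N0 orbT.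
rewrite -ler_pdivrMl // mulrC; apply: ltW; apply: lt_le_trans (truncnS_gt _) _.
by rewrite ler_nat leq_addr.
Qed.

End Limits.

(** * The seminorms induced by [e], by its differences [d] and by [z] *)

Section Averages.
Variables (R : realType) (X : lmodType R) (e : nat -> X) (nu : X -> R).
Hypotheses (nuS : seminorm nu) (spr : one_spreading nu e).
Variables (Z : normedModType R) (z : nat -> Z).
Hypothesis zlim : forall (n : nat) (a : nat -> R),
  (fun N => nu (lincomb (interval_average e N) n a)) @ \oo --> (`|lincomb z n a| : R).

Let E p := nu (lin e p).
Let d i := e i.*2 - e i.*2.+1.
Let D p := nu (lin d p).
Let Zn p := `|lin z p|.

Lemma nu_spread f p : (forall i, (f i < f i.+1)%N) -> nu (lin (e \o f) p) = nu (lin e p).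
Proof. by move=> h; apply: spr; exact/increasing_seqP. Qed.

Lemma nu_e i : nu (e i) = nu (e 0%N).
Proof.
rewrite -[RHS]/(nu (e 0%N)) -(linX e 0) -(@nu_spread (fun j => (j + i)%N)).
  by rewrite linX.
by move=> j; rewrite addSn.
Qed.

Lemma interval_averageE N i :
  interval_average e N i = N%:R^-1 *: \sum_(t < N) e (i * N + t)%N.
Proof.
rewrite /interval_average -{1}[(i * N)%N]add0n big_addn mulSn addnK big_mkord.
by congr (_ *: _); apply: eq_bigr => t _; rewrite addnC.
Qed.

Lemma z_lim p : (fun N => nu (lin (interval_average e N) p)) @ \oo --> (Zn p : R).
Proof. exact: zlim. Qed.

(* For each [t < N] the sequence [k i * N + i + t] is strictly increasing in [i],
   even where [k] is constant; the average over [t] is close to the interval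
   average number [k i]. *)
Lemma merge_average k p N : nondec k -> (0 < N)%N ->
  nu (lin (interval_average e N \o k) p) <=
    E p + (\sum_(i < size p) `|p`_i| * ((2 * i)%:R * nu (e 0%N))) / N%:R.
Proof.
move=> hk N0.
pose v i := \sum_(t < N) e (k i * N + t)%N.
pose w i := \sum_(t < N) e (k i * N + i + t)%N.
have hv : nu (lin v p) <= N%:R * E p +
    \sum_(i < size p) `|p`_i| * ((2 * i)%:R * nu (e 0%N)).
  apply: le_trans (sn_ler_sub nuS _ (lin w p)) _; apply: lerD.
    pose w' t i := e (k i * N + i + t)%N.
    rewrite (lin_suml N w'); apply: (sn_average nuS (F := fun t => lin (w' t) p)) => t _.
    rewrite (@nu_spread (fun i => k i * N + i + t)%N) // => i.
    rewrite ltn_add2r addnS ltnS leq_add2r leq_mul2r hk ?orbT //.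
  rewrite -linBl; apply: le_trans (sn_lin nuS _ _) _.
  apply: ler_sum => i _; rewrite ler_wpM2l // -(snN nuS) opprB.
  by apply: (sn_shift nuS) => j; rewrite nu_e.
have -> : lin (interval_average e N \o k) p = N%:R^-1 *: lin v p.
  by rewrite -linZl; apply: eq_lin => i _ /=; rewrite interval_averageE.
rewrite (snZ nuS) ger0_norm ?invr_ge0 // mulrC ler_pdivrMr ?ltr0n //.
rewrite mulrDl mulfVK ?pnatr_eq0 -?lt0n //.
by rewrite mulrC in hv.
Qed.

(** The limit of [merge_average], whose error term is O(1/N). *)
Lemma merge_le_E k p : nondec k -> `|lin (z \o k) p| <= E p.
Proof.
move=> hk; rewrite -lin_collapse; apply: (cvgn_le_addinv _ (@z_lim (collapse k p))) => N N0.
by rewrite lin_collapse; apply: merge_average.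
Qed.

(** Spread each coordinate uniformly over an interval of length [N]. Merging along
    [j |-> k (j %/ N)] undoes this and lands at [k i], so [merge_le_E] bounds the left side by [nu]
    of the combination of interval averages, which tends to [Zn p]. *)
Lemma Z_merge k p : nondec k -> Zn (collapse k p) <= Zn p.
Proof.
move=> hk; rewrite /Zn lin_collapse; apply: (le_cvgn _ (@z_lim p)) => N N0.
pose y i : {poly R} := N%:R^-1 *: \sum_(t < N) 'X^(i * N + t).
have hy (V : lmodType R) (x : nat -> V) i : lin x (y i) = N%:R^-1 *: \sum_(t < N) x (i * N + t)%N.
  rewrite linearZ linear_sum; congr (_ *: _).
  by apply: eq_bigr => t _ /=; rewrite linX.
have -> : lin (interval_average e N) p = lin e (lin y p).
  by rewrite lin_comp; apply: eq_lin => i _ /=; rewrite hy interval_averageE.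
have -> : lin (z \o k) p = lin (z \o (fun j => k (j %/ N)%N)) (lin y p).
  rewrite lin_comp; apply: eq_lin => i _ /=; rewrite hy /=.
  rewrite (eq_bigr (fun=> z (k i))); last first.
    by move=> t _; rewrite divnMDl // divn_small ?addn0.
  by rewrite sumr_const card_ord -[_ (k i) *+ N]scaler_nat scalerA mulVf ?scale1r // pnatr_eq0 -lt0n.
by apply: merge_le_E => i j ij; apply: hk; exact: leq_div2r.
Qed.

Lemma Z_le_E p : Zn p <= E p.
Proof. by rewrite -[X in Zn X]lin_id; apply: le_trans (merge_le_E p (k := id) _); rewrite ?lin_id. Qed.

(** Interleaving [u] and [v] gives one increasing map [g], along which the vector is a spread copy
    of [lin d p]. *)
Lemma D_interleaved u v p :
  (forall i, (u i < v i)%N) -> (forall i, (v i < u i.+1)%N) ->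
  nu (lin (fun i => e (u i) - e (v i)) p) = D p.
Proof.
move=> uv vu.
pose q := lin (fun i => 'X^(i.*2) - 'X^(i.*2.+1)) p : {poly R}.
pose g l := if odd l then v l./2 else u l./2.
have hg l : (g l < g l.+1)%N.
  rewrite /g /=; case: ifPn => ol.
    by rewrite uphalf_half ol add1n.
  by rewrite uphalf_half (negbTE ol) add0n.
have hq (x : nat -> X) : lin x q = lin (fun i => x i.*2 - x i.*2.+1) p.
  by rewrite /q lin_comp; apply: eq_lin => i _ /=; rewrite linearB /= !linX.
rewrite /D /d -hq -(nu_spread q hg) hq; congr nu; apply: eq_lin => i _ /=.
by rewrite /g /= odd_double doubleK /= uphalf_double.
Qed.

Lemma D_spread f p : (forall i, (f i < f i.+1)%N) -> D (collapse f p) = D p.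
Proof.
move=> hf; rewrite {1}/D lin_collapse (@D_interleaved (fun i => (f i).*2) (fun i => (f i).*2.+1)) //.
by move=> i; have := hf i; lia.
Qed.

Lemma D_seminorm : seminorm D. Proof. exact: (seminorm_comp (lin d) nuS). Qed.
Lemma E_seminorm : seminorm E. Proof. exact: (seminorm_comp (lin e) nuS). Qed.
Lemma Z_seminorm : seminorm Zn.
Proof. exact: (seminorm_comp (lin z) (seminorm_norm Z)). Qed.

Lemma D_le_2E p : D p <= 2 * E p.
Proof.
rewrite /D linBl; apply: le_trans (sn_triB nuS _ _) _.
rewrite (@nu_spread (fun i => i.*2)) ?(@nu_spread (fun i => i.*2.+1)) /E; first by lra.
  by move=> i; rewrite doubleS.
by move=> i; rewrite doubleS.
Qed.

(* [e i] minus the average of its next [N] shifts is an average of differences,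
   which [D] controls uniformly in [N]. *)
Lemma E_le_DZ p : E p <= D p + Zn p.
Proof.
suff h N : (0 < N)%N -> E p - D p <= nu (lin (interval_average e N) p).
  by rewrite -lerBlDl; exact: (le_cvgn h (@z_lim p)).
move=> N0; rewrite lerBlDr.
rewrite {1}/E -(@nu_spread (fun i => (i * N)%N)); last by move=> i; rewrite mulSn -add1n leq_add2r.
apply: le_trans (sn_ler_sub nuS _ (lin (interval_average e N) p)) _.
rewrite lerD2l -linBl.
pose w t i := e (i * N)%N - e (i * N + t)%N.
have -> : lin (fun i => (e \o (fun j => (j * N)%N)) i - interval_average e N i) p =
    N%:R^-1 *: \sum_(t < N) lin (w t) p.
  rewrite -(lin_suml N w) -linZl; apply: eq_lin => i _ /=.
  rewrite interval_averageE sumrB sumr_const card_ord scalerBr -[X in _ *: X - _]scaler_nat.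
  by rewrite scalerA mulVf ?scale1r // pnatr_eq0 -lt0n.
rewrite (snZ nuS) ger0_norm ?invr_ge0 // mulrC ler_pdivrMr ?ltr0n // mulrC.
(* For [t = 0] the two indices coincide and the vector is 0; otherwise they interleave. *)
apply: (sn_average nuS (F := fun t => lin (w t) p)) => -[|t] tN.
  rewrite (eq_lin (y' := fun=> 0)); last by move=> i _; rewrite /w addn0 subrr.
  by rewrite lin_const scaler0 (sn0 nuS) (sn_ge0 D_seminorm).
by rewrite (@D_interleaved (fun i => i * N)%N (fun i => i * N + t.+1)%N) // => i; nia.
Qed.

Lemma coefZX (p : {poly R}) (a : R) i j : (p - a *: 'X^j)`_i = p`_i - a * (i == j)%:R.
Proof. by rewrite coefB coefZ coefXn. Qed.

(* Shifting the j-th difference by [t < N], and all later ones by [N], does not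
   change the norm; the average over [t] of the shifted differences telescopes
   to a vector of norm O(1/N). *)
Lemma D_remove (p : {poly R}) j : D (p - p`_j *: 'X^j) <= D p.
Proof.
set p' := p - _; apply: (@ler_addinv _ _ _ (`|p`_j| * (2 * nu (e 0%N)))) => N N0.
pose u t i := if (i < j)%N then i.*2 else if i == j then (i.*2 + t)%N else (i.*2 + N)%N.
pose y t i := e (u t i) - e (u t i).+1.
have hy t q : (t < N)%N -> nu (lin (y t) q) = D q.
  move=> tN; rewrite (@D_interleaved (u t) (fun i => (u t i).+1)) // => i; rewrite /u.
  by case: (ltngtP i j) => ij; case: (ltngtP i.+1 j) => ij'; lia.
have yp' t : lin (y t) p' = lin (y 0%N) p'.
  apply: eq_lin => i; rewrite coefZX; rewrite /y /u; case: (eqVneq i j) => [->|//].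
  by rewrite mulr1 subrr eqxx.
have yp t : lin (y 0%N) p' = lin (y t) p - p`_j *: y t j.
  by rewrite -(yp' t) /p' linearB /= linearZ /= linX.
have hsum : N%:R *: lin (y 0%N) p' = \sum_(t < N) lin (y t) p
    - p`_j *: (e j.*2 - e (j.*2 + N)%N).
  rewrite -[N in N%:R](card_ord N) scaler_nat -sumr_const (eq_bigr _ (fun t _ => yp (val t))).
  rewrite sumrB -scaler_sumr; congr (_ - _ *: _).
  under eq_bigr do rewrite /y /u ltnn eqxx.
  elim: N  {N0 u y hy p' yp' yp} => [|M IH]; first by rewrite big_ord0 addn0 subrr.
  by rewrite big_ord_recr /= IH addrA subrK addnS.
have : nu (N%:R *: lin (y 0%N) p') <= N%:R * D p + `|p`_j| * (2 * nu (e 0%N)).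
  rewrite hsum; apply: le_trans (sn_triB nuS _ _) _; apply: lerD.
    by apply: (sn_average nuS (F := fun t => lin (y t) p)) => t tN; rewrite hy.
  rewrite (snZ nuS) ler_wpM2l //; apply: le_trans (sn_triB nuS _ _) _.
  by rewrite nu_e (nu_e (_ + _)); lra.
rewrite (snZ nuS) hy // ger0_norm // => h.
rewrite -(ler_pM2l (_ : 0 < N%:R)) ?ltr0n // mulrDr.
by rewrite mulrCA divff ?mulr1 // pnatr_eq0 -lt0n.
Qed.

End Averages.

(** * Multipliers, convex blocks and merging for abstract seminorms *)

Section Blocks.
Variable R : realType.
Implicit Types (p : {poly R}) (q : nat -> {poly R}).

(** The supports are only contained in the intervals [[n k, n k.+1)], which leave no gap after
    [n 0]; every later index is thus owned by exactly one block. *)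
Definition iblock (n : nat -> nat) q :=
  (forall k, (n k < n k.+1)%N) /\
  (forall k i, (q k)`_i != 0 -> (n k <= i < n k.+1)%N).

Definition convex_poly p := (forall i, 0 <= p`_i) /\ p.[1] = 1.

Definition ones (N : nat) : {poly R} := \sum_(t < N) 'X^t.

Lemma coef_ones N i : (ones N)`_i = (i < N)%N%:R.
Proof.
rewrite coef_sum; have [iN|iN] := ltnP i N.
  rewrite (bigD1 (Ordinal iN)) //= coefXn eqxx big1 ?addr0 // => j ji.
  by rewrite coefXn; case: eqP => // ij; case/negP: ji; apply/eqP/val_inj.
by rewrite big1 // => j _; rewrite coefXn gtn_eqF // (leq_trans (ltn_ord j)).
Qed.

Lemma horner_ones N : (ones N).[1] = N%:R.
Proof.
rewrite horner_sum (eq_bigr (fun=> 1)); first by rewrite sumr_const card_ord.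
by move=> i _; rewrite hornerXn expr1n.
Qed.

(** The coordinates are treated one at a time: multiplying the m-th one by [th m] is a convex
    combination of doing nothing and of removing it. *)
Lemma coefmul_decomp (N : {poly R} -> R) : seminorm N ->
  (forall p j, N (p - p`_j *: 'X^j) <= N p) ->
  forall th p, (forall i, 0 <= th i <= 1) -> N (coefmul th p) <= N p.
Proof.
move=> NS hN th p hth.
(* Only the first [m] multipliers are in force, for an induction on [m]. *)
pose thm m i := if (i < m)%N then th i else 1.
have -> : coefmul th p = coefmul (thm (size p)) p.
  apply/polyP => i; rewrite !coef_coefmul /thm; case: ltnP => // hi.
  by rewrite nth_default // !mulr0.
elim: (size p) => [|m IH].
  suff -> : coefmul (thm 0%N) p = p by [].
  by apply/polyP => i; rewrite coef_coefmul mul1r.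
set r := coefmul (thm m) p in IH.
have -> : coefmul (thm m.+1) p = th m *: r + (1 - th m) *: (r - r`_m *: 'X^m).
  apply/polyP => i; rewrite coefD !coefZ coefB coefZ coefXn !coef_coefmul /thm ltnS.
  by case: (ltngtP i m) => [_|_|->]; rewrite ?ltnn ?eqxx /=; ring.
apply: le_trans (sn_tri NS _ _) _; rewrite !(snZ NS).
have /andP[h0 h1] := hth m; rewrite !ger0_norm ?subr_ge0 //.
have := ler_wpM2l h0 IH.
have : (1 - th m) * N (r - r`_m *: 'X^m) <= (1 - th m) * N p.
  by rewrite ler_wpM2l ?subr_ge0 // (le_trans (hN _ _)).
lra.
Qed.

(** The positive and negative parts of [p] are both coordinate projections of [p]; each contributes
    one [N p]. *)
Lemma suppression_l1 (N : {poly R} -> R) delta :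
  (forall p (A : pred nat), N (coefmul (fun i => (A i)%:R) p) <= N p) ->
  (forall p, (forall i, 0 <= p`_i) -> delta * p.[1] <= N p) ->
  (forall p, N (- p) = N p) ->
  forall p, delta * \sum_(i < size p) `|p`_i| <= 2 * N p.
Proof.
move=> hA hd hN p.
pose P := coefmul (fun i => (0 <= p`_i)%R%:R) p.
pose M := coefmul (fun i => (p`_i < 0)%R%:R) p.
have P0 : forall i, 0 <= P`_i.
  by move=> i; rewrite coef_coefmul /=; case: (lerP 0 p`_i); rewrite ?mul1r ?mul0r.
have M0 : forall i, 0 <= (- M)`_i.
  by move=> i; rewrite coefN coef_coefmul /=; case: (ltrP p`_i 0); rewrite ?mul1r ?mul0r; lra.
have hP : delta * P.[1] <= N p by apply: le_trans (hd _ P0) (hA _ _).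
have hM : delta * (- M).[1] <= N p by apply: le_trans (hd _ M0) _; rewrite hN; exact: hA.
suff : delta * \sum_(i < size p) `|p`_i| = delta * P.[1] + delta * (- M).[1] by lra.
have sz th : (size (coefmul th p) <= size p)%N.
  by apply/leq_sizeP => j hj; rewrite coef_coefmul nth_default // mulr0.
rewrite -mulrDr (horner1E (sz _)) (horner1E (m := size p)) ?size_polyN ?sz //.
rewrite -big_split /=; congr (_ * _); apply: eq_bigr => i _.
rewrite coefN !coef_coefmul /=; case: (lerP 0 p`_i) => [h|h].
  by rewrite ger0_norm // mul1r mul0r subr0.
by rewrite ltr0_norm // mul1r mul0r add0r.
Qed.

(* Choosing one index in each block at random, with the coefficients as
   probabilities, writes [lin q p] as a mean of spread copies of [p]. *)
Lemma convex_blocks_le (N : {poly R} -> R) n q : seminorm N ->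
  (forall f p, (forall i, (f i < f i.+1)%N) -> N (collapse f p) <= N p) ->
  iblock n q -> (forall k, convex_poly (q k)) -> forall p, N (lin q p) <= N p.
Proof.
move=> NS hN [n1 hq] cq p.
(* The first [m] blocks are kept and each later one is replaced by a unit vector chosen in its
   interval; [m = 0] gives a spread copy of [p]. *)
pose Q m (f : nat -> nat) k : {poly R} := if (k < m)%N then q k else 'X^(f k).
have -> : lin q p = lin (Q (size p) n) p.
  apply: eq_lin => i pi; rewrite /Q; case: ltnP => // hi.
  by rewrite nth_default ?eqxx in pi.
suff h m f : (forall k, n k <= f k < n k.+1)%N -> N (lin (Q m f) p) <= N p.
  by apply: h => k; rewrite leqnn n1.
elim: m f => [|m IH] f hf.
  apply: hN => i; have /andP[_ h1] := hf i; have /andP[h2 _] := hf i.+1.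
  exact: leq_trans h1 h2.
pose g i k := if k == m then i else f k.
have -> : lin (Q m.+1 f) p = \sum_(i < size (q m)) (q m)`_i *: lin (Q m (g i)) p.
  rewrite (eq_bigr (fun i : 'I__ => lin (fun k => (q m)`_i *: Q m (g i) k) p)); last first.
    by move=> i _; rewrite linZl.
  rewrite -(lin_suml _ (fun i k => (q m)`_i *: Q m (g i) k)); apply: eq_lin => k _.
  rewrite /Q /g ltnS; case: (ltngtP k m) => [_|_|->].
  - by rewrite -scaler_suml -horner1_lin (cq m).2 scale1r.
  - by rewrite -scaler_suml -horner1_lin (cq m).2 scale1r.
  - by rewrite -[LHS]lin_id.
apply: (sn_convex NS); [by move=> i; exact: (cq m).1|by rewrite -horner1_lin (cq m).2|].
move=> i hi; apply: IH => k; rewrite /g; case: eqVneq => [->|_]; last exact: hf.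
exact: hq.
Qed.

Lemma coef_collapse k p t :
  (collapse k p)`_t = \sum_(i < size p | k i == t) p`_i.
Proof.
rewrite coef_lin [RHS]big_mkcond; apply: eq_bigr => i _.
by rewrite coefXn eq_sym; case: eqP; rewrite ?mulr1 ?mulr0.
Qed.

(** By nonnegativity, the normalized restrictions of [p] to the fibres of [k] are convex blocks, and
    a spread copy of [p] is their combination with coefficients [collapse k p]; [convex_blocks_le]
    concludes. *)
Lemma merge_nonneg_ge (N : {poly R} -> R) k p : seminorm N ->
  (forall f p, (forall i, (f i < f i.+1)%N) -> N (collapse f p) = N p) ->
  nondec k -> (forall i, 0 <= p`_i) -> N p <= N (collapse k p).
Proof.
move=> NS hN hk p0; have [->|pn0] := eqVneq p 0; first by rewrite linear0.
have s0 : (0 < size p)%N by rewrite size_poly_gt0.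
(* The stretch [f] sends the fibre of [k] over [t] into [t * s, (t + 1) * s), so
   that the fibres become blocks even when some of them are empty. *)
set s := size p in s0 *; pose f i := (i + k i * s)%N.
have hf i : (f i < f i.+1)%N.
  by rewrite /f addSn ltnS leq_add2l leq_mul2r hk ?orbT.
rewrite -(hN f p hf); set r := collapse k p.
have r0 (t : nat) : 0 <= r`_t by rewrite coef_collapse sumr_ge0.
pose w (t : nat) : {poly R} := \sum_(i < s | k i == t) p`_i *: 'X^(f i).
(* A fibre of mass 0 cannot be normalized; a unit vector in its interval stands in, with coefficient
   0. *)
pose q (t : nat) := if r`_t == 0 then 'X^(t * s) else (r`_t)^-1 *: w t.
have cw (t i : nat) : (w t)`_i = \sum_(j < s | k j == t) p`_j * (i == f j)%:R.
  by rewrite coef_sum; apply: eq_bigr => j _; rewrite coefZ coefXn.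
have w1 (t : nat) : (w t).[1] = r`_t.
  by rewrite coef_collapse horner_sum; apply: eq_bigr => j _; rewrite hornerZ hornerXn expr1n mulr1.
have rq (t : nat) : r`_t *: q t = w t.
  rewrite /q; case: eqVneq => [rt0|rt]; last by rewrite scalerA divff ?scale1r.
  rewrite rt0 scale0r; apply/esym/big1 => i ki.
  suff -> : p`_i = 0 by rewrite scale0r.
  move: rt0; rewrite coef_collapse => /eqP; rewrite psumr_eq0 // => /allP/(_ i).
  by rewrite mem_index_enum ki => /(_ isT)/eqP.
have -> : collapse f p = lin q r.
  rewrite /lin (eq_bigr (fun t : 'I__ => w t)) => [|t _]; last by rewrite rq.
  rewrite /collapse /lin /w (exchange_big_dep xpredT) //=; apply: eq_bigr => i _.
  have [->|pi] := eqVneq p`_i 0.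
    by rewrite scale0r big1 // => t _; rewrite scale0r.
  have hi : (k i < size r)%N.
    rewrite ltnNge; apply/negP => hr; have := nth_default 0 hr.
    rewrite coef_collapse (bigD1 i) //= => /eqP; rewrite paddr_eq0 ?sumr_ge0 // => /andP[].
    by rewrite (negbTE pi).
  by rewrite (big_pred1 (Ordinal hi)).
apply: (@convex_blocks_le _ (fun t => t * s)%N) => //.
- by move=> g x hg; rewrite hN.
- split=> [t|t i]; first by rewrite mulSn -[ltnLHS]add0n ltn_add2r.
  rewrite /q; case: (eqVneq r`_t 0) => _.
    rewrite coefXn; case: (eqVneq i (t * s)%N) => [->|]; last by rewrite eqxx.
    by rewrite leqnn mulSn -[ltnLHS]add0n ltn_add2r.
  rewrite coefZ mulf_eq0 negb_or => /andP[_]; apply: contraNT => hi.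
  rewrite cw big1 // => j /eqP kj; case: eqP => [ij|]; last by rewrite mulr0.
  case/negP: hi; rewrite ij /f kj leq_addl mulSn ltn_add2r; exact: ltn_ord.
move=> t; rewrite /q; case: (eqVneq r`_t 0) => [_|rt]; split.
- by move=> i; rewrite coefXn.
- by rewrite hornerXn expr1n.
- move=> i; rewrite coefZ mulr_ge0 ?invr_ge0 // cw sumr_ge0 // => j _.
  by rewrite mulr_ge0.
- by rewrite hornerZ w1 mulVf.
Qed.

End Blocks.

(** * Small averages of the differences *)

Section AveragesSmall.
Variables (R : realType) (X : lmodType R) (e : nat -> X) (nu : X -> R).
Hypotheses (nuS : seminorm nu) (spr : one_spreading nu e).
Variables (Z : normedModType R) (z : nat -> Z).
Hypothesis zlim : forall (n : nat) (a : nat -> R),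
  (fun N => nu (lincomb (interval_average e N) n a)) @ \oo --> (`|lincomb z n a| : R).

Let E p := nu (lin e p).
Let d i := e i.*2 - e i.*2.+1.
Let D p := nu (lin d p).
Let Zn p := `|lin z p|.

(** Conditionality in finite form: the coordinate projections have no common bound.
    [unconditional_of_suppression] links it to rearrangements. *)
Hypothesis cond : ~ exists K : R, forall p (A : pred nat),
  E (coefmul (fun i => (A i)%:R) p) <= K * E p.

Let DS : seminorm D. Proof. exact: (D_seminorm e nuS). Qed.
Let ES : seminorm E. Proof. exact: (E_seminorm e nuS). Qed.

Let DSp f q : (forall i, (f i < f i.+1)%N) -> D (collapse f q) = D q.
Proof. exact: (D_spread spr). Qed.

Let DX j : D 'X^j = D 1.
Proof.
rewrite -(@DSp (fun k => (k + j)%N) 1) => [|k]; last by rewrite addSn.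
by rewrite [collapse _ _]linC.
Qed.

Lemma D_coefmul th p : (forall i, 0 <= th i <= 1) -> D (coefmul th p) <= D p.
Proof. by apply: (coefmul_decomp DS) => q j; exact: (D_remove nuS spr). Qed.

Lemma nat_of_bool_01 (b : bool) : 0 <= (b%:R : R) <= 1.
Proof. by case: b; rewrite ?lexx ?ler01. Qed.

(* If [z 0 = 0], the long averages of [e] tend to 0, and averaging the shifts of
   [e j] removes the j-th coordinate. *)
Lemma E_remove (p : {poly R}) j : z 0%N = 0 -> E (p - p`_j *: 'X^j) <= E p.
Proof.
move=> z0; set p' := p - _.
have lim : (fun N => E p + `|p`_j| * nu (lin (interval_average e N) 1)) @ \oo
    --> (E p : R).
  rewrite -[X in _ --> X]addr0; apply: cvgD; first exact: cvg_cst.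
  rewrite -[X in _ --> X](mulr0 `|p`_j|); apply: cvgMl_tmp.
  by rewrite -[X in _ --> X](normr0 Z) -z0 -linC; exact: z_lim.
apply: (le_cvgn _ lim) => N N0.
pose u t i := if (i < j)%N then i else if i == j then (i + t)%N else (i + N)%N.
have hy t q : (t < N)%N -> nu (lin (e \o u t) q) = E q.
  move=> tN; rewrite nu_spread // => i; rewrite /u.
  by case: (ltngtP i j) => ij; case: (ltngtP i.+1 j) => ij'; lia.
have yp' t : lin (e \o u t) p' = lin (e \o u 0%N) p'.
  apply: eq_lin => i; rewrite coefZX /u /=; case: (eqVneq i j) => [->|//].
  by rewrite mulr1 subrr eqxx.
have yp t : lin (e \o u 0%N) p' = lin (e \o u t) p - p`_j *: e (j + t)%N.
  by rewrite -(yp' t) /p' linearB /= linearZ /= linX /= /u ltnn eqxx.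
have hsum : N%:R *: lin (e \o u 0%N) p' = \sum_(t < N) lin (e \o u t) p
    - p`_j *: \sum_(t < N) e (j + t)%N.
  rewrite -[N in N%:R](card_ord N) scaler_nat -sumr_const (eq_bigr _ (fun t _ => yp (val t))).
  by rewrite sumrB -scaler_sumr.
have hs : nu (\sum_(t < N) e (j + t)%N) = N%:R * nu (lin (interval_average e N) 1).
  rewrite linC interval_averageE (snZ nuS) ger0_norm ?invr_ge0 // mulVKf ?pnatr_eq0 -?lt0n //.
  have spread1 k : nu (\sum_(t < N) e (k + t)%N) = E (ones R N).
    rewrite /E -(nu_spread spr (f := fun t => (k + t)%N)) => [|i]; last by rewrite addnS.
    by rewrite /ones linear_sum; congr nu; apply: eq_bigr => t _ /=; rewrite linX /= addnC.
  by rewrite !spread1.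
have : nu (N%:R *: lin (e \o u 0%N) p') <=
    N%:R * E p + `|p`_j| * (N%:R * nu (lin (interval_average e N) 1)).
  rewrite hsum; apply: le_trans (sn_triB nuS _ _) _; apply: lerD.
    by apply: (sn_average nuS (F := fun t => lin (e \o u t) p)) => t tN; rewrite hy.
  by rewrite (snZ nuS) hs.
rewrite (snZ nuS) hy // ger0_norm // mulrCA -mulrDr.
by rewrite ler_pM2l ?ltr0n.
Qed.

(** Otherwise [E_remove] makes all coordinate projections contractive for [E]. *)
Lemma z0_neq0 : z 0%N != 0.
Proof.
apply/eqP => z0; apply: cond; exists 1 => p A; rewrite mul1r.
apply: (coefmul_decomp ES) => [q j|i]; first exact: E_remove.
exact: nat_of_bool_01.
Qed.

Lemma E_lin_bound p : E p <= E 1 * \sum_(i < size p) `|p`_i|.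
Proof.
apply: le_trans (sn_lin nuS _ _) _; rewrite mulrC mulr_suml.
by apply: ler_sum => i _; rewrite (nu_e spr) /E linC.
Qed.

(** The sum of the shifts of [r] by [t < N] has [D]-norm at most [N%:R * D r], and it differs from
    [r.[1] *: ones R N] only at the ends of the windows, by an amount bounded independently of
    [N]. *)
Lemma ones_shift_le r N : D (r.[1] *: ones R N) <=
  N%:R * D r + \sum_(i < size r) `|r`_i| * ((2 * i)%:R * D 1).
Proof.
pose w t i : {poly R} := 'X^(0 + i + t).
have -> : r.[1] *: ones R N = lin (fun=> \sum_(t < N) 'X^(0 + t)) r.
  by rewrite lin_const.
apply: le_trans (sn_ler_sub DS _ (lin (fun i => \sum_(t < N) w t i) r)) _; apply: lerD.
  rewrite lin_suml; apply: (sn_average DS (F := fun t => lin (w t) r)) => t _.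
  by rewrite -(@DSp (fun k => (k + t)%N) r).
rewrite -linBl; apply: le_trans (sn_lin DS _ _) _.
apply: ler_sum => i _; rewrite ler_wpM2l // -(snN DS) opprB.
by apply: (@sn_shift _ _ _ DS (fun i => 'X^i) (D 1) 0%N i N) => j; rewrite DX.
Qed.

(* Otherwise [D] dominates the l_1 norm, and hence so does [E]. *)
Lemma D_average_small eps : 0 < eps ->
  exists2 N, (0 < N)%N & D (ones R N.+1) < eps * N.+1%:R.
Proof.
move=> eps0; apply: contrapT => hno.
have h2 N : (0 < N)%N -> eps * N.+1%:R <= D (ones R N.+1).
  by move=> N0; rewrite leNgt; apply/negP => hN; apply: hno; exists N.
have pos (r : {poly R}) : (forall i, 0 <= r`_i) -> eps * r.[1] <= D r.
  move=> r0; have r10 : 0 <= r.[1] by rewrite horner1_lin sumr_ge0.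
  apply: (@ler_addinv _ _ _ (\sum_(i < size r) `|r`_i| * ((2 * i)%:R * D 1))) => N N0.
  set K := \sum_(_ < _) _.
  have := ones_shift_le r N.+1; rewrite -/K (snZ DS) ger0_norm // => h.
  have {h} := le_trans (ler_wpM2l r10 (h2 N N0)) h.
  have N1 : 0 < (N.+1%:R : R) by rewrite ltr0n.
  rewrite mulrA -ler_pdivlMr // => h.
  rewrite mulrC; apply: le_trans h _.
  rewrite mulrDl mulrAC divff ?gt_eqF // mul1r lerD2l.
  have K0 : 0 <= K by apply: sumr_ge0 => i _; rewrite !mulr_ge0 // (sn_ge0 DS).
  by rewrite ler_wpM2l // lef_pV2 ?posrE ?ltr0n // ler_nat.
(* The 4 combines the factor 2 of [suppression_l1] with that of [D_le_2E]. *)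
apply: cond; exists (E 1 * (4 / eps)) => p A.
apply: le_trans (E_lin_bound _) _.
have szA : (size (coefmul (fun i => (A i)%:R) p) <= size p)%N.
  by apply/leq_sizeP => j hj; rewrite coef_coefmul nth_default // mulr0.
rewrite -mulrA ler_wpM2l ?(sn_ge0 ES) //.
have := suppression_l1 _ pos (snN DS) p => /(_ (fun q A => D_coefmul q (fun i => nat_of_bool_01 (A i)))).
have := D_le_2E nuS spr p; rewrite -/(D p) -/(E p) => hE hl.
rewrite mulrAC ler_pdivlMr // mulrC; apply: le_trans (_ : 2 * D p <= _); last by lra.
apply: le_trans hl; rewrite ler_pM2l //.
apply: le_trans (_ : \sum_(i < size p) `|(coefmul (fun i => (A i)%:R) p)`_i| <= _).
  rewrite (big_ord_widen _ (fun i => `|(coefmul (fun i => (A i)%:R) p)`_i|) szA).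
  by rewrite big_mkcond; apply: ler_sum => i _; case: ifP.
apply: ler_sum => i _; rewrite coef_coefmul normrM -[leRHS]mul1r ler_wpM2r //.
by case: (A i); rewrite ?normr1 ?normr0.
Qed.

Lemma D_small_coefs (p : {poly R}) N : (0 < N)%N ->
  (forall i, 0 <= p`_i <= N%:R^-1) -> p.[1] = 1 ->
  D p <= 2 / N%:R * D (ones R N.+1).
Proof.
move=> N0 hp p1.
have Npos : 0 < (N%:R : R) by rewrite ltr0n.
have p0 i : 0 <= p`_i by have /andP[] := hp i.
pose C i := \sum_(j < i) p`_j.
have C0 i : 0 <= C i by apply: sumr_ge0.
have CS i : C i.+1 = C i + p`_i by rewrite /C big_ord_recr.
have Cmono i j : (i <= j)%N -> C i <= C j.
  elim: j => [|j IH]; first by rewrite leqn0 => /eqP->.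
  rewrite leq_eqVlt => /predU1P[->//|]; rewrite ltnS => /IH h.
  by rewrite CS; have := p0 j; lra.
have C1 i : C i <= 1.
  rewrite -p1 (horner1E (leq_maxl (size p) i)); exact/Cmono/leq_maxr.
(* The cumulative sums cut the indices into at most [N + 1] bins, each of mass at
   most [2 / N]; merging each bin can only increase [D]. *)
pose k i := Num.truncn (N%:R * C i).
have hk : nondec k.
  by move=> i j ij; apply: le_truncn; rewrite ler_pM2l //; exact: Cmono.
have kE i : (k i)%:R <= N%:R * C i < (k i).+1%:R by apply: truncn_itv; rewrite mulr_ge0.
have kN i : (k i <= N)%N.
  rewrite -(ler_nat R); have /andP[h _] := kE i; apply: le_trans h _.
  by rewrite -[leRHS]mulr1 ler_pM2l.
pose m n t := \sum_(i < n | k i == t) p`_i.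
have m_le n t : m n t <= Num.max 0 (C n - t%:R / N%:R).
  elim: n => [|n IH]; first by rewrite /m big_ord0 le_max lexx.
  rewrite /m big_mkcond big_ord_recr -big_mkcond /= -/(m n t) CS.
  move: IH; rewrite !le_max; have := p0 n; case: eqP => [kt|_].
    have : t%:R / N%:R <= C n by rewrite ler_pdivrMr // mulrC -kt; case/andP: (kE n).
    by move=> h1 h2 /orP[h|h]; apply/orP; right; lra.
  by move=> h1 /orP[h|h]; apply/orP; [left|right]; lra.
(* Before its last index a bin holds at most [C n - t / N < 1 / N], and that index adds at most
   [1 / N]. *)
have m_le2 n t : m n t <= 2 / N%:R.
  elim: n => [|n IH]; first by rewrite /m big_ord0 divr_ge0.
  rewrite /m big_mkcond big_ord_recr -big_mkcond /= -/(m n t).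
  case: eqP => [kt|_]; last by rewrite addr0.
  have /andP[_ h1] := hp n; have := m_le n t.
  have /andP[_ h2] := kE n; rewrite kt mulrC -ltr_pdivlMr // -addn1 natrD mulrDl div1r in h2.
  have : 0 < N%:R^-1 :> R by rewrite invr_gt0.
  by rewrite le_max => h3 /orP[h4|h4]; lra.
apply: le_trans (merge_nonneg_ge DS DSp hk p0) _.
have Npos2 : 0 < 2 / N%:R :> R by rewrite divr_gt0.
(* The merged vector is [2 / N *: ones R N.+1] with multipliers in [0, 1]. *)
pose th t := (collapse k p)`_t / (2 / N%:R).
have -> : collapse k p = coefmul th (2 / N%:R *: ones R N.+1).
  apply/polyP => t; rewrite coef_coefmul coefZ coef_ones ltnS /th.
  case: leqP => tN; first by rewrite mulr1 divfK // gt_eqF.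
  rewrite !mulr0 coef_collapse big_pred0 // => i.
  by apply/negbTE/negP => /eqP kt; have := kN i; rewrite kt leqNgt tN.
apply: le_trans (D_coefmul _ _) _; last by rewrite (snZ DS) ger0_norm // ltW.
move=> t; rewrite /th divr_ge0 ?(ltW Npos2) //=; last by rewrite coef_collapse sumr_ge0.
by rewrite ler_pdivrMr // mul1r coef_collapse; exact: m_le2.
Qed.

End AveragesSmall.

(** * Convergence at a rate 1/k, and closed spans *)

Section Complete.
Variable R : realType.

Lemma inv_nat_lt (eps : R) : 0 < eps -> exists N, forall k, (N <= k)%N -> k.+1%:R^-1 < eps.
Proof.
move=> eps0; exists (Num.truncn eps^-1) => k hk.
rewrite invf_plt ?posrE ?ltr0n //; apply: lt_le_trans (truncnS_gt _) _.
by rewrite ler_nat ltnS.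
Qed.

Lemma cvgn_rate (V : completeNormedModType R) (u : nat -> V) (B : R) :
  (forall k l, `|u k - u l| <= B * (k.+1%:R^-1 + l.+1%:R^-1)) -> cvgn u.
Proof.
move=> h.
have B0 : 0 <= B.
  have := h 0%N 0%N; rewrite subrr normr0 invr1; lra.
apply: cauchy_cvg; apply: cauchy_exP => eps eps0.
have B1 : 0 < 2 * (B + 1) by lra.
have [N hN] := inv_nat_lt (divr_gt0 eps0 B1).
exists (u N), N => // k /= Nk; rewrite -ball_normE /=; apply: le_lt_trans (h _ _) _.
have h1 := hN _ (leqnn N); have h2 := hN _ Nk.
move: h1 h2; rewrite !ltr_pdivlMr //.
have : 0 <= N.+1%:R^-1 :> R by rewrite invr_ge0.
have : 0 <= k.+1%:R^-1 :> R by rewrite invr_ge0.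
move: (N.+1%:R^-1 : R) (k.+1%:R^-1 : R) => a b; nra.
Qed.

Lemma cvgn_rate_lim (V : normedModType R) (u : nat -> V) v (B : R) :
  (forall k, `|v - u k| <= B / k.+1%:R) -> u @ \oo --> v.
Proof.
move=> h; apply/cvgrPdist_lt => /= eps eps0.
have B0 : 0 <= B by have := h 0%N; rewrite divr1; apply: le_trans.
have B1 : 0 < B + 1 by lra.
have [N hN] := inv_nat_lt (divr_gt0 eps0 B1).
exists N => // k /= /hN; rewrite ltr_pdivlMr; last by lra.
move=> hk; apply: le_lt_trans (h _) _; apply: le_lt_trans hk.
by rewrite mulrC ler_wpM2l ?invr_ge0 //; lra.
Qed.

Lemma closed_spanP (V : normedModType R) (x : nat -> V) v :
  closed_span x v <-> forall eps : R, 0 < eps -> exists p, `|v - lin x p| < eps.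
Proof.
split=> [h eps eps0|h B /nbhs_ballP[eps eps0 hB]].
  have [w [[n [a ->]] hw]] := h _ (nbhsx_ballx v eps eps0).
  by exists (\poly_(i < n) a i); rewrite lin_poly; move: hw; rewrite -ball_normE.
have [p hp] := h _ eps0; exists (lin x p); split; last by apply: hB; rewrite -ball_normE.
by exists (size p), (fun i => p`_i).
Qed.

End Complete.

(** * Separation of the [z i] and bounded coordinates *)

Section Distinct.
Variables (R : realType) (X : completeNormedModType R) (e : nat -> X) (nu : X -> R).
Hypotheses (nuS : seminorm nu) (spr : one_spreading nu e).
Variables (c C : R).
Hypotheses (c0 : 0 < c) (C0 : 0 < C) (nu_equiv : forall v, c * `|v| <= nu v <= C * `|v|).
Variables (Z : normedModType R) (z : nat -> Z).
Hypothesis zlim : forall (n : nat) (a : nat -> R),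
  (fun N => nu (lincomb (interval_average e N) n a)) @ \oo --> (`|lincomb z n a| : R).
Hypothesis basis : schauder_basis e.

Let E p := nu (lin e p).
Let d i := e i.*2 - e i.*2.+1.
Let D p := nu (lin d p).
Let Zn p := `|lin z p|.

Hypothesis cond : ~ exists K : R, forall p (A : pred nat),
  E (coefmul (fun i => (A i)%:R) p) <= K * E p.

Let DS : seminorm D. Proof. exact: (D_seminorm e nuS). Qed.
Let ES : seminorm E. Proof. exact: (E_seminorm e nuS). Qed.

(* If [z 0 = z 1], suitable averages of [e] form a Cauchy sequence whose limit is
   nonzero and invariant under the shift [e i |-> e i.+1]; by uniqueness, all the
   coefficients of its expansion vanish. *)
Lemma z0_neq_z1 : z 0%N != z 1%N.
Proof.
apply/eqP => z01.
(* Merging along the map that fixes 0 and sends every other index to [i.+1] bounds the distance of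
   [z i.+1] and [z 0] by that of [z 1] and [z 0]. *)
have zE i : z i = z 0%N.
  case: i => [//|i]; apply/eqP; rewrite -subr_eq0 -normr_le0.
  have := Z_merge nuS spr zlim (k := fun j => if j == 0%N then 0%N else i.+1) ('X^1 - 1).
  have hz1 : lin z ('X^1 - 1) = 0 by rewrite linearB /= linX linC z01 subrr.
  have -> : collapse (fun j => if j == 0%N then 0%N else i.+1) ('X^1 - 1 : {poly R}) = 'X^(i.+1) - 1.
    by rewrite linearB /= collapse_X /collapse linC.
  rewrite hz1 linearB /= linX linC normr0; apply.
  by move=> a b; case: eqP => // ha; case: eqP => // hb; lia.
have Z0 p : lin z p = p.[1] *: z 0%N.
  by rewrite -lin_const; apply: eq_lin => i _; rewrite zE.
(* All [z i] being equal, the [Z]-norm only sees the mass. *)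
have EDZ p : p.[1] = 0 -> E p <= D p.
  move=> p1; apply: le_trans (E_le_DZ nuS spr zlim p) _.
  by rewrite Z0 p1 scale0r normr0 addr0.
have /choice[N hN] : forall k, exists N, D (N.+1%:R^-1 *: ones R N.+1) < k.+1%:R^-1.
  move=> k; have k0 : 0 < k.+1%:R^-1 :> R by rewrite invr_gt0.
  have [N _ hN] := D_average_small nuS spr cond k0.
  exists N; rewrite (snZ DS) ger0_norm ?invr_ge0 //.
  by rewrite mulrC ltr_pdivrMr ?ltr0n.
pose A k := (N k).+1%:R^-1 *: ones R (N k).+1.
have A1 k : (A k).[1] = 1 by rewrite hornerZ horner_ones mulVf // pnatr_eq0.
pose a k := lin e (A k).
have norm_le v : `|v| <= c^-1 * nu v.
  by rewrite mulrC ler_pdivlMr // mulrC; have /andP[] := nu_equiv v.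
have ca : cvgn a.
  apply: (@cvgn_rate _ _ _ c^-1) => k l; apply: le_trans (norm_le _) _.
  rewrite ler_pM2l ?invr_gt0 // /a -linearB /= -/(E _).
  apply: le_trans (EDZ _ _) _; first by rewrite hornerD hornerN !A1 subrr.
  by apply: le_trans (sn_triB DS _ _) _; apply: lerD; [exact: ltW (hN k)|exact: ltW (hN l)].
have [x0 hx0] : exists x0 : X, a @ \oo --> x0 by exact/cvg_ex.
have [b [hb ub]] := basis.2 x0 I.
pose b' i := if i is j.+1 then b j else 0.
have dist (x : nat -> X) : x @ \oo --> x0 -> forall eps : R, 0 < eps -> \forall n \near \oo, nu (x0 - x n) < eps.
  move=> hx eps eps0; have [M _ hM] := cvgr_dist_lt _ _ hx _ (divr_gt0 eps0 C0).
  exists M => // n /= /hM /=; rewrite ltr_pdivlMr // mulrC => h.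
  by apply: le_lt_trans h; have /andP[] := nu_equiv (x0 - x n).
have hb' : is_expansion e b' x0.
  rewrite /is_expansion -cvg_shiftS; apply/cvgrPdist_lt => /= eps eps0.
  (* Five errors are added: the distance from [x0] to [a k] twice, [D (A k)] twice, and the distance
     from [x0] to the partial sum once. *)
  have eps' : 0 < c * eps / 5 by rewrite divr_gt0 // mulr_gt0.
  have [M _ hM] := dist _ hx0 _ eps'.
  have [M' hM'] := inv_nat_lt eps'.
  pose k := maxn M M'.
  have /= h1 := hM k (leq_maxl _ _); have /= h2 := hM' k (leq_maxr _ _).
  have [M1 _ hM1] := dist _ hb _ eps'; exists M1 => // n /= /hM1 /= h3.
  rewrite -(ltr_pM2l c0); apply: le_lt_trans (_ : _ <= nu (x0 - series (fun i => b' i *: e i) n.+1)) _.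
    by have /andP[] := nu_equiv (x0 - series (fun i => b' i *: e i) n.+1).
  pose pn : {poly R} := \poly_(i < n) b i.
  have hn : series (fun i => b i *: e i) n = lin e pn.
    by rewrite lin_poly /series /= big_mkord.
  have hn' : series (fun i => b' i *: e i) n.+1 = lin (e \o S) pn.
    by rewrite lin_poly /series /= big_mkord big_ord_recl scale0r add0r.
  rewrite hn'; rewrite hn in h3.
  have -> : x0 - lin (e \o S) pn = (x0 - a k) +
      (lin e (A k - collapse S (A k)) + lin (e \o S) (A k - pn)).
    by rewrite !linearB /= lin_collapse /a [X in _ = _ + X]addrA subrK addrA subrK.
  have h4 : nu (lin (e \o S) (A k - pn)) <= nu (x0 - a k) + nu (x0 - lin e pn).
    rewrite (nu_spread spr) // linearB /= -/(a k).
    have -> : a k - lin e pn = (x0 - lin e pn) - (x0 - a k).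
      by rewrite opprB [RHS]addrC addrA subrK.
    by rewrite [leRHS]addrC; exact: (sn_triB nuS).
  have h5 : nu (lin e (A k - collapse S (A k))) <= 2 * D (A k).
    apply: le_trans (EDZ _ _) _; first by rewrite hornerD hornerN collapse_horner1 subrr.
    apply: le_trans (sn_triB DS _ _) _.
    by rewrite [D (collapse _ _)](D_spread spr) // -/(D _); lra.
  have h6 := hN k.
  apply: le_lt_trans (sn_tri nuS _ _) _.
  apply: le_lt_trans (lerD (lexx _) (sn_tri nuS _ _)) _.
  have {h6 h2} h6 : D (A k) < c * eps / 5 by exact: lt_trans h2.
  have -> : c * eps = (c * eps / 5) * 5 by rewrite divfK.
  move: (c * eps / 5) h1 h3 h6 => t h1 h3 h6; lra.
have bb' := ub _ hb'.
have b_0 i : b i = 0.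
  by elim: i => [|i IH]; rewrite bb' //= -IH bb'.
have x00 : x0 = 0.
  have hs : series (fun i => b i *: e i) = cst 0.
    apply/funext => n; rewrite /series /= big1 // => i _.
    by rewrite b_0 scale0r.
  by move: hb; rewrite /is_expansion hs => /(cvg_unique (@norm_hausdorff _ X)); apply; exact: cvg_cst.
(* The limit cannot be 0: as [A M] has mass 1, [Z_le_E] bounds [nu (a M)] from below by the norm of
   [z 0]. *)
have z0 : 0 < `|z 0%N| by rewrite normr_gt0 (z0_neq0 nuS spr zlim cond).
have [M _ /(_ M (leqnn M))] := dist _ hx0 _ z0.
rewrite /= x00 sub0r (snN nuS) => h.
have := Z_le_E nuS spr zlim (A M); rewrite Z0 A1 scale1r => h'.
by have := le_lt_trans h' h; rewrite ltxx.
Qed.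

(** Merging the indices below [m] to 0 and the others to 1 leaves [p.[1] *: z 0] plus the m-th tail
    sum times [z 1 - z 0], so every tail sum is bounded. A coordinate is a difference of two
    consecutive tail sums. *)
Lemma Z_coef : exists2 B : R, 0 < B & forall (p : {poly R}) i, `|p`_i| <= B * Zn p.
Proof.
have z0 : 0 < `|z 0%N| by rewrite normr_gt0 (z0_neq0 nuS spr zlim cond).
have z1 : 0 < `|z 1%N - z 0%N| by rewrite normr_gt0 subr_eq0 eq_sym z0_neq_z1.
pose tail m (p : {poly R}) : R := \sum_(i < size p | (m <= i)%N) p`_i.
have hm p : `|p.[1]| * `|z 0%N| <= Zn p.
  have := Z_merge nuS spr zlim (k := fun=> 0%N) p; rewrite lin_collapse lin_const normrZ.
  by apply => i j _.
have ht m p : `|tail m p| * `|z 1%N - z 0%N| <= 2 * Zn p.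
  have := Z_merge nuS spr zlim (k := fun i => nat_of_bool (m <= i)%N) p.
  rewrite lin_collapse.
  have -> : lin (z \o (fun i => nat_of_bool (m <= i)%N)) p =
      tail m p *: (z 1%N - z 0%N) + p.[1] *: z 0%N.
    rewrite horner1_lin /tail !scaler_suml [X in X + _]big_mkcond -big_split.
    apply: eq_bigr => i _ /=; case: leqP => _ /=; last by rewrite add0r.
    by rewrite -scalerDr subrK.
  have hk : nondec (fun i => nat_of_bool (m <= i)%N).
    by move=> i j ij; case: (leqP m i) => // mi; rewrite (leq_trans mi ij).
  move=> /(_ hk) h; have := hm p.
  have := ler_normD (tail m p *: (z 1%N - z 0%N) + p.[1] *: z 0%N) (- (p.[1] *: z 0%N)).
  by rewrite addrK normrN !normrZ -/(Zn p) in h *; lra.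
exists (4 / `|z 1%N - z 0%N|); first by rewrite divr_gt0.
move=> p i; rewrite mulrAC ler_pdivlMr //.
have -> : p`_i = tail i p - tail i.+1 p.
  have [hi|hi] := ltnP i (size p); last first.
    rewrite nth_default // /tail !big1 ?subrr // => j.
      by move=> /ltnW hj; have := leq_trans hi hj; rewrite leqNgt ltn_ord.
    by move=> hj; have := leq_trans hi hj; rewrite leqNgt ltn_ord.
  rewrite /tail (bigD1 (Ordinal hi)) //= [X in _ + X - _](_ : _ = tail i.+1 p) ?addrK //.
  apply: eq_bigl => j; rewrite ltn_neqAle andbC; congr (_ && _).
  by rewrite eq_sym.
have := ler_wpM2r (ltW z1) (ler_normB (tail i p) (tail i.+1 p)).
by rewrite mulrDl; have := ht i p; have := ht i.+1 p; lra.
Qed.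

End Distinct.

(** * Choice of subsequences and blocks; ownership of indices *)

Section Selection.
Variable R : realType.

Lemma subsequence_choice (P : nat -> nat -> Prop) :
  (forall n j, exists k, (n <= k)%N /\ P j k) ->
  exists f : nat -> nat, (forall i, (f i < f i.+1)%N) /\ forall j, P j (f j).
Proof.
move=> h; have /choice[g hg] : forall nj : nat * nat, exists k, (nj.1 <= k)%N /\ P nj.2 k.
  by move=> [n j]; exact: h.
pose f := fix f j := if j is i.+1 then g ((f i).+1, i.+1) else g (0%N, 0%N).
exists f; split=> [i|[|j]].
- exact: (hg ((f i).+1, i.+1)).1.
- exact: (hg (0%N, 0%N)).2.
- exact: (hg ((f j).+1, j.+1)).2.
Qed.

Lemma block_choice (P : nat -> {poly R} -> Prop) :
  (forall n j, exists p : {poly R}, (forall i, p`_i != 0 -> (n <= i)%N) /\ P j p) ->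
  exists n q, iblock n q /\ forall j, P j (q j).
Proof.
move=> h; have /choice[g hg] : forall nj : nat * nat, exists p : {poly R},
    (forall i, p`_i != 0 -> (nj.1 <= i)%N) /\ P nj.2 p.
  by move=> [n j]; exact: h.
(* The maximum keeps [n] strictly increasing even when the chosen block is 0. *)
pose n := fix n j := if j is i.+1 then maxn (n i).+1 (size (g (n i, i))) else 0%N.
exists n, (fun j => g (n j, j)); split=> [|j]; last exact: (hg (n j, j)).2.
split=> [k|k i hi]; first by rewrite leq_max leqnn.
rewrite ((hg (n k, k)).1 i hi) /= leq_max; apply/orP; right.
by rewrite ltnNge; apply: contra hi => hi; rewrite nth_default.
Qed.

(** Indices before [n 0] lie in no interval; they are sent to 0, which keeps [k] nondecreasing. *)
Lemma owner (n : nat -> nat) : (forall k, (n k < n k.+1)%N) ->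
  exists k : nat -> nat, [/\ nondec k,
    forall i, (n 0 <= i)%N -> (n (k i) <= i < n (k i).+1)%N &
    forall l i, (n l <= i < n l.+1)%N -> k i = l].
Proof.
move=> hn.
have ex i : (n 0%N <= i)%N -> exists k, (n k <= i < n k.+1)%N.
  elim: i => [|i IH] hi; first by exists 0%N; rewrite hi (leq_ltn_trans _ (hn 0%N)).
  move: hi; rewrite leq_eqVlt => /predU1P[<-|]; first by exists 0%N; rewrite leqnn hn.
  rewrite ltnS => /IH[k /andP[h1 h2]].
  move: h2; rewrite leq_eqVlt => /predU1P[h2|h2]; last by exists k; rewrite h2 leqW.
  by exists k.+1; rewrite h2 leqnn hn.
have /choice[k hk] : forall i, exists k, if (n 0 <= i)%N then (n k <= i < n k.+1)%N else k == 0%N.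
  by move=> i; case: leqP => [/ex//|_]; exists 0%N.
have hk1 i : (n 0 <= i)%N -> (n (k i) <= i < n (k i).+1)%N by move=> hi; have := hk i; rewrite hi.
have mono l l' i j : (i <= j)%N -> (n l <= i < n l.+1)%N -> (n l' <= j < n l'.+1)%N -> (l <= l')%N.
  move=> ij /andP[h1 h2] /andP[h3 h4]; rewrite leqNgt; apply/negP => ll.
  have := incr_le hn ll; lia.
exists k; split=> // [i j ij|l i hl].
  have [hi|hi] := leqP (n 0%N) i.
    exact: (mono _ _ i j ij (hk1 i hi) (hk1 j (leq_trans hi ij))).
  by have := hk i; rewrite leqNgt hi => /eqP->.
have h0 : (n 0 <= i)%N by apply: leq_trans (incr_le hn (leq0n l)) _; case/andP: hl.
by apply/eqP; rewrite eqn_leq (mono _ _ i i (leqnn i) (hk1 i h0) hl) (mono _ _ i i _ hl (hk1 i h0)).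
Qed.

(** Merging along this map keeps the blocks in [A] and concentrates the others at their left ends,
    where a block of mass 0 vanishes; merging then acts as a suppression of blocks. *)
Lemma block_collapse (n : nat -> nat) (A : pred nat) : (forall k, (n k < n k.+1)%N) ->
  exists k : nat -> nat, nondec k /\
    forall l i, (n l <= i < n l.+1)%N -> k i = if A l then i else n l.
Proof.
move=> hn; have [k [nk k1 k2]] := owner hn.
pose f i := if (i < n 0)%N then 0%N else if A (k i) then i else n (k i).
have hf i : (n 0 <= i)%N -> (n (k i) <= f i <= i)%N.
  move=> hi; rewrite /f ltnNge hi /=; have /andP[h1 h2] := k1 i hi.
  by case: ifP => _; rewrite leqnn ?h1.
exists f; split=> [i j ij|l i hl]; last first.
  have h0 : (n 0 <= i)%N by apply: leq_trans (incr_le hn (leq0n l)) _; case/andP: hl.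
  by rewrite /f ltnNge h0 /= (k2 _ _ hl).
have [hi|hi] := ltnP i (n 0); first by rewrite /f hi.
have hj := leq_trans hi ij.
have := nk i j ij; rewrite leq_eqVlt => /predU1P[kij|kij].
  rewrite /f !ltnNge hi hj /= kij; case: ifP => // _.
have /andP[_ h1] := hf i hi; have /andP[h2 _] := hf j hj.
have /andP[_ h3] := k1 i hi; have := incr_le hn kij; lia.
Qed.

Lemma iblock_sub n (q : nat -> {poly R}) f : iblock n q -> (forall i, (f i < f i.+1)%N) ->
  iblock (n \o f) (q \o f).
Proof.
move=> [hn hq] hf; split=> [k|k i /hq/andP[h1 h2]] /=; first exact: incr_lt.
by rewrite h1 (leq_trans h2) // (incr_le hn).
Qed.

Lemma iblock_lin n q m (r : nat -> {poly R}) : iblock n q -> iblock m r ->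
  iblock (n \o m) (fun j => lin q (r j)).
Proof.
move=> [hn hq] [hm hr]; split=> [k|j i] /=; first exact: incr_lt.
rewrite coef_lin => h.
have [k hk] : exists k : 'I_(size (r j)), (r j)`_k * (q k)`_i != 0.
  apply: contrapT => hno; case/eqP: h; apply: big1 => k _.
  by apply/eqP/negP => /negP hk; apply: hno; exists k.
move: hk; rewrite mulf_eq0 negb_or => /andP[/hr/andP[h1 h2] /hq/andP[h3 h4]].
by rewrite (leq_trans (incr_le hn h1) h3) (leq_trans h4) // (incr_le hn).
Qed.

Lemma convex_lin (q : nat -> {poly R}) p : convex_poly p -> (forall k, convex_poly (q k)) ->
  convex_poly (lin q p).
Proof.
move=> [p0 p1] hq; split=> [i|].
  by rewrite coef_lin sumr_ge0 // => k _; rewrite mulr_ge0 // (hq k).1.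
rewrite horner_lin -[RHS]p1 horner1_lin; apply: eq_bigr => k _.
by rewrite (hq k).2 mulr1.
Qed.

(** Absorbs geometrically small perturbations of the blocks by a bound on the coordinates. *)
Lemma geometric_sum (p : {poly R}) w B eps : 0 <= eps -> (forall i, `|p`_i| <= B) ->
  (forall i, w i <= eps * 2^-1 ^+ i) ->
  \sum_(i < size p) `|p`_i| * w i <= 2 * eps * B.
Proof.
move=> eps0 hB hw.
have B0 : 0 <= B by apply: le_trans (hB 0%N).
apply: le_trans (_ : \sum_(i < size p) B * eps * 2^-1 ^+ i <= _).
  apply: ler_sum => i _; rewrite -mulrA.
  apply: le_trans (ler_wpM2l _ (hw i)) _ => //.
  by rewrite ler_wpM2r // mulr_ge0 // exprn_ge0.
rewrite -mulr_sumr.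
suff : \sum_(i < size p) 2^-1 ^+ i <= 2 :> R.
  by have := mulr_ge0 B0 eps0; nra.
suff -> : \sum_(i < size p) 2^-1 ^+ i = 2 - 2 * 2^-1 ^+ size p :> R.
  by have := exprn_ge0 (size p) (_ : 0 <= 2^-1 :> R); rewrite invr_ge0 ler0n => /(_ isT); lra.
elim: (size p) => [|m IH]; first by rewrite big_ord0 expr0 mulr1 subrr.
by rewrite big_ord_recr /= IH exprS; lra.
Qed.

End Selection.

(** The block arguments that follow rest on these facts alone. [geoD_average] gives a positive [N]
    and a bound on [ones R N.+1] in the form in which [geoD_small] consumes them. *)
Record geometry (R : realType) (E D Z : {poly R} -> R) : Prop := Geometry {
  geoE : seminorm E;
  geoD : seminorm D;
  geoZ : seminorm Z;
  geoDE : forall p, D p <= 2 * E p;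
  geoZE : forall p, Z p <= E p;
  geoEDZ : forall p, E p <= D p + Z p;
  geoD_spread : forall f p, (forall i, (f i < f i.+1)%N) -> D (collapse f p) = D p;
  geoD_coefmul : forall th p, (forall i, 0 <= th i <= 1) -> D (coefmul th p) <= D p;
  geoZ_merge : forall k p, nondec k -> Z (collapse k p) <= Z p;
  geoD_average : forall eps, 0 < eps ->
    exists2 N, (0 < N)%N & D (ones R N.+1) < eps * N.+1%:R;
  geoD_small : forall (p : {poly R}) N, (0 < N)%N ->
    (forall i, 0 <= p`_i <= N%:R^-1) -> p.[1] = 1 ->
    D p <= 2 / N%:R * D (ones R N.+1);
  geoZ_coef : exists2 B : R, 0 < B & forall (p : {poly R}) i, `|p`_i| <= B * Z p
}.

Definition comparable_norms (R : realType) (N1 N2 : {poly R} -> R) :=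
  exists c C : R, [/\ 0 < c, 0 < C & forall p, c * N1 p <= N2 p <= C * N1 p].

(** * Convex blocks with small [D]-norms *)

Section Geometry.
Variables (R : realType) (E D Z : {poly R} -> R).
Hypothesis G : geometry E D Z.

Let ES := geoE G.
Let DS := geoD G.
Let ZS := geoZ G.

Lemma comparable_normsI (N1 N2 : {poly R} -> R) C1 C2 :
  (forall p, 0 <= N1 p) -> (forall p, 0 <= N2 p) ->
  (forall p, N1 p <= C1 * N2 p) -> (forall p, N2 p <= C2 * N1 p) ->
  comparable_norms N1 N2.
Proof.
move=> h1 h2 h3 h4; exists (`|C1| + 1)^-1, (`|C2| + 1).
have a1 : 0 < `|C1| + 1 by rewrite ltr_wpDl.
have a2 : 0 < `|C2| + 1 by rewrite ltr_wpDl.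
rewrite invr_gt0; split=> // p; apply/andP; split.
  rewrite mulrC ler_pdivrMr // mulrC; apply: le_trans (h3 p) _.
  by rewrite ler_wpM2r //; have := ler_norm C1; lra.
apply: le_trans (h4 p) _.
by rewrite ler_wpM2r //; have := ler_norm C2; lra.
Qed.

Lemma Z_convex n q p : iblock n q -> (forall k, convex_poly (q k)) -> Z (lin q p) <= Z p.
Proof.
move=> hq cq; apply: (convex_blocks_le ZS _ hq cq) => f r hf.
by apply: (geoZ_merge G) => i j; exact: incr_le.
Qed.

Lemma D_convex n q p : iblock n q -> (forall k, convex_poly (q k)) -> D (lin q p) <= D p.
Proof.
move=> hq cq; apply: (convex_blocks_le DS _ hq cq) => f r hf.
by rewrite (geoD_spread G).
Qed.

Lemma collapse_const k (q : {poly R}) l : (forall i, q`_i != 0 -> k i = l) ->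
  collapse k q = q.[1] *: 'X^l.
Proof. by move=> h; rewrite -lin_const; apply: eq_lin => i /h ->. Qed.

(** Merging along [owner] leaves of each block its mass, placed at the number of the block. *)
Lemma Z_mass_le n q p : iblock n q -> Z (lin (fun k => (q k).[1] *: 'X^k) p) <= Z (lin q p).
Proof.
move=> [hn hq]; have [k [nk _ k2]] := owner hn.
apply: le_trans (geoZ_merge G _ nk); rewrite lin_comp.
rewrite le_eqVlt (eq_lin (y' := collapse k \o q)) ?eqxx // => l _ /=.
by rewrite (collapse_const (l := l)) // => i /hq/k2.
Qed.

Lemma Z_point_le n q p : iblock n q ->
  Z (lin (fun k => (q k).[1] *: 'X^(n k)) p) <= Z (lin q p).
Proof.
move=> [hn hq]; have [k [nk k2]] := block_collapse pred0 hn.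
apply: le_trans (geoZ_merge G _ nk); rewrite lin_comp.
rewrite le_eqVlt (eq_lin (y' := collapse k \o q)) ?eqxx // => l _ /=.
by rewrite (collapse_const (l := n l)) // => i /hq/k2.
Qed.

Lemma Z_X i : Z 'X^i <= Z 1.
Proof.
have := geoZ_merge G 1 (k := fun=> i); rewrite [collapse _ _]linC; apply.
by move=> a b _.
Qed.

(** Above, [E <= D + Z], where [Z] does not increase on convex blocks and the [D]-norms sum to at
    most [2 * B * Z p]. Below, [Z_mass_le] with all masses 1. *)
Lemma convex_comparable n q : iblock n q -> (forall k, convex_poly (q k)) ->
  (forall j, D (q j) <= 2^-1 ^+ j) -> comparable_norms (fun p => E (lin q p)) Z.
Proof.
move=> hq cq hD; have [B B0 hB] := geoZ_coef G.
apply: (@comparable_normsI _ _ (1 + 2 * B) 1) => p; rewrite ?(sn_ge0 ES) ?(sn_ge0 ZS) //.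
  apply: le_trans (geoEDZ G _) _; rewrite mulrDl mul1r addrC.
  apply: lerD (Z_convex _ hq cq) _; apply: le_trans (sn_lin DS _ _) _.
  have := @geometric_sum _ p (fun j => D (q j)) (B * Z p) 1 ler01 (hB p).
  by rewrite mulr1 mulrA; apply => i; rewrite mul1r.
rewrite mul1r; apply: le_trans (geoZE G _); apply: le_trans (Z_mass_le _ hq).
rewrite le_eqVlt (eq_lin (y' := fun k => 'X^k)) ?lin_id ?eqxx // => k _.
by rewrite (cq k).2 scale1r.
Qed.

(** Long averages have small [D]-norm, and by [D_convex] they keep it when taken over the blocks
    [q]. *)
Lemma average_blocks n q : iblock n q -> (forall k, convex_poly (q k)) ->
  exists m r, [/\ iblock m r, forall j, convex_poly (r j),
    forall j, exists c, forall i, (r j)`_i != 0 -> (r j)`_i = c &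
    comparable_norms (fun p => E (lin (fun j => lin q (r j)) p)) Z].
Proof.
move=> hq cq.
have [|m [r [hr hP]]] := @block_choice R (fun j r => [/\ convex_poly r,
    exists c, forall i, r`_i != 0 -> r`_i = c & D (lin q r) <= 2^-1 ^+ j]).
  move=> s j; have e0 : 0 < 2^-1 ^+ j :> R by rewrite exprn_gt0 // invr_gt0.
  have [N _ hN] := geoD_average G e0.
  (* The average over the [N.+1] indices from [s] on, beyond the blocks already chosen. *)
  exists (N.+1%:R^-1 *: collapse (fun t => t + s)%N (ones R N.+1)).
  have cE i : (N.+1%:R^-1 *: collapse (fun t => t + s)%N (ones R N.+1))`_i =
      N.+1%:R^-1 * ((s <= i)%N && (i - s < N.+1)%N)%:R.
    rewrite coefZ coef_collapse; congr (_ * _).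
    case: (leqP s i) => [si|is_] /=; last first.
      by rewrite big_pred0 // => t; apply/negbTE; rewrite neq_ltn (leq_trans is_) ?leq_addl ?orbT.
    have [h|h] := ltnP (i - s) (size (ones R N.+1)).
      rewrite (big_pred1 (Ordinal h)) /=; first by rewrite coef_ones.
      by move=> t /=; rewrite -val_eqE /=; apply/eqP/eqP; lia.
    rewrite big_pred0; first by have := nth_default 0 h; rewrite coef_ones => ->.
    by move=> t; apply/eqP => ti; move: h; rewrite -ti addnK leqNgt ltn_ord.
  split; first by move=> i; rewrite cE; case: (leqP s i) => //=; rewrite mulr0 eqxx.
  split.
  - split=> [i|]; first by rewrite cE mulr_ge0 // invr_ge0.
    by rewrite hornerZ collapse_horner1 horner_ones mulVf // pnatr_eq0.
  - exists N.+1%:R^-1 => i; rewrite cE; case: (_ && _); rewrite ?mulr1 //.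
    by rewrite mulr0 eqxx.
  apply: le_trans (D_convex _ hq cq) _; rewrite (snZ DS) (geoD_spread G); last first.
    by move=> i; rewrite addSn.
  rewrite ger0_norm ?invr_ge0 // mulrC ler_pdivrMr ?ltr0n //; exact: ltW.
exists m, r; split=> //; try by move=> j; case: (hP j).
apply: (@convex_comparable (n \o m)); first exact: iblock_lin.
  by move=> j; apply: convex_lin => //; case: (hP j).
by move=> j; case: (hP j).
Qed.

End Geometry.

Lemma bounded_cluster (R : realType) (s : nat -> R) M : (forall k, `|s k| <= M) ->
  exists l, forall eps, 0 < eps -> forall n, exists k, (n <= k)%N /\ `|s k - l| < eps.
Proof.
move=> hM.
have h0 : (s @ \oo) `[- M, M]%classic.
  by exists 0%N => // k _ /=; rewrite in_itv /= -ler_norml.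
have [l [_ hl]] := @segment_compact R (- M) M (s @ \oo) _ h0.
exists l => eps eps0 n.
have h1 : (s @ \oo) (s @` [set k | (n <= k)%N]) by exists n => // k hk; exists k.
have [_ [[k /= nk <-]]] := hl _ _ h1 (nbhsx_ballx l eps eps0).
by rewrite -ball_normE /= distrC => h; exists k.
Qed.

(* The mass of each block is carried to the left end of its block in the
   [Z]-part, so that the blocks measured by [Z] have coefficients of sum 0. *)
Definition centered_norm (R : realType) (D Z : {poly R} -> R) (n : nat -> nat)
    (q : nat -> {poly R}) (p : {poly R}) : R :=
  D (lin q p) + Z (lin (fun k => q k - (q k).[1] *: 'X^(n k)) p).

(** * Subsequences of convex block sequences *)

Section Sequences.
Variables (R : realType) (E D Z : {poly R} -> R).
Hypothesis G : geometry E D Z.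

Let ES := geoE G.
Let DS := geoD G.
Let ZS := geoZ G.

(** Above, convex blocks increase neither [D] nor [Z]. Below, [Z p] is recovered from the masses,
    and [mu * D p] by suppressing every coefficient except the large ones. *)
Lemma convex_large_comparable n q mu i : iblock n q -> (forall k, convex_poly (q k)) ->
  0 < mu -> (forall k, mu < (q k)`_(i k)) -> comparable_norms (fun p => E (lin q p)) E.
Proof.
move=> hq cq mu0 hmu; have [hn hs] := hq.
have hi k : (n k <= i k < n k.+1)%N.
  by apply: hs; rewrite gt_eqF // (lt_trans mu0).
have ii k : (i k < i k.+1)%N.
  by have /andP[_ h1] := hi k; have /andP[h2 _] := hi k.+1; exact: leq_trans h2.
apply: (@comparable_normsI _ _ _ 3 (1 + 2 / mu)) => p; rewrite ?(sn_ge0 ES) //.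
  apply: le_trans (geoEDZ G _) _.
  have := D_convex G p hq cq; have := Z_convex G p hq cq.
  by have := geoDE G p; have := geoZE G p; lra.
have hZ : Z p <= E (lin q p).
  apply: le_trans (geoZE G _); apply: le_trans (Z_mass_le G _ hq).
  rewrite le_eqVlt (eq_lin (y' := fun k => 'X^k)) ?lin_id ?eqxx // => k _.
  by rewrite (cq k).2 scale1r.
have [k [_ _ k2]] := owner hn.
(* Keeps one index in each block and lowers its coefficient to the common value [mu]. *)
pose th t := if t == i (k t) then mu / (q (k t))`_t else 0.
have hth t : 0 <= th t <= 1.
  rewrite /th; case: eqP => [->|_]; last by rewrite lexx ler01.
  have hk := hmu (k t); have hk' : k (i (k t)) = k t by apply: k2; exact: hi.
  rewrite hk' divr_ge0 ?(ltW mu0) ?(ltW (lt_trans mu0 hk)) //=.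
  by rewrite ler_pdivrMr ?mul1r ?(ltW hk) // (lt_trans mu0).
have hD : mu * D p <= 2 * E (lin q p).
  rewrite -(geoD_spread G p ii) -[mu]gtr0_norm // -(snZ DS).
  have -> : mu *: collapse i p = coefmul th (lin q p).
    rewrite (lin_comp (coefmul th)) /collapse -linZl; apply: eq_lin => l _ /=.
    apply/polyP => t; rewrite coefZ coefXn coef_coefmul.
    have [qt|qt] := eqVneq (q l)`_t 0.
      rewrite qt mulr0; case: eqP => [ti|]; rewrite ?mulr0 //.
      by have := lt_trans mu0 (hmu l); rewrite -ti qt ltxx.
    rewrite /th (k2 l t (hs _ _ qt)); case: eqP => _; last by rewrite mulr0 mul0r.
    by rewrite mulr1 divfK.
  by apply: le_trans (geoD_coefmul G _ hth) _; exact: (geoDE G).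
apply: le_trans (geoEDZ G _) _; rewrite mulrDl mul1r addrC; apply: lerD hZ _.
by rewrite mulrAC ler_pdivlMr // mulrC.
Qed.

(** Either arbitrarily small [D]-norms occur arbitrarily far out and a subsequence decreases fast,
    or they are eventually bounded below and [geoD_small] forces a large coefficient into each
    block. *)
Lemma convex_subsequence n q : iblock n q -> (forall k, convex_poly (q k)) ->
  exists f, (forall i, (f i < f i.+1)%N) /\
    (comparable_norms (fun p => E (lin (q \o f) p)) E \/
     comparable_norms (fun p => E (lin (q \o f) p)) Z).
Proof.
move=> hq cq.
have [hsmall|hlarge] := pselect (forall N j, exists k, (N <= k)%N /\ D (q k) <= 2^-1 ^+ j).
  have [f [hf hP]] := @subsequence_choice (fun j k => D (q k) <= 2^-1 ^+ j) hsmall.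
  exists f; split=> //; right; apply: (convex_comparable G (iblock_sub hq hf)) => //.
  by move=> k; exact: cq.
have [N [j hN]] : exists N j, forall k, (N <= k)%N -> 2^-1 ^+ j < D (q k).
  apply: contrapT => hno; apply: hlarge => N j; apply: contrapT => hno2; apply: hno.
  exists N, j => k Nk; rewrite ltNge; apply/negP => h; apply: hno2; by exists k.
have d0 : 0 < 2^-1 ^+ j :> R by rewrite exprn_gt0 // invr_gt0.
move: (2^-1 ^+ j : R) d0 hN => delta d0 hN.
(* With all coefficients at most [1 / N1], the [D]-norm would be at most
   [2 / N1 * (delta / 4 * N1.+1) <= delta], since [N1.+1 <= 2 * N1]. *)
have d4 : 0 < delta / 4 by rewrite divr_gt0.
have [N1 N10 hN1] := geoD_average G d4.
have N1R : 0 < N1%:R :> R by rewrite ltr0n.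
have /choice[i hi] : forall k, exists i, N1%:R^-1 < (q (N + k)%N)`_i.
  move=> k; apply: contrapT => hno.
  have h i : 0 <= (q (N + k)%N)`_i <= N1%:R^-1.
    rewrite (cq _).1 /= leNgt; apply/negP => h; apply: hno; by exists i.
  have := geoD_small G N10 h (cq _).2; have := hN _ (leq_addr k N) => h1 h2.
  have := lt_le_trans h1 h2; apply/negP; rewrite -leNgt.
  apply: le_trans (ler_wpM2l _ (ltW hN1)) _; first by rewrite divr_ge0.
  have : N1.+1%:R <= 2 * N1%:R :> R by rewrite -natrM ler_nat; lia.
  rewrite mulrAC ler_pdivrMr // => h3.
  have := ler_wpM2l (ltW d0) h3; lra.
exists (fun k => (N + k)%N); split=> [k|]; first by rewrite addnS.
left; apply: (@convex_large_comparable (n \o (fun k => (N + k)%N)) _ N1%:R^-1 i) => //.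
- by apply: iblock_sub => // k; rewrite addnS.
- by move=> k; exact: cq.
- by rewrite invr_gt0.
Qed.

(** * Signed blocks and the centered norm *)

Section Signed.
Variables (n : nat -> nat) (q : nat -> {poly R}).
Hypothesis hq : iblock n q.

Let s k := (q k).[1].
Let u k := q k - s k *: 'X^(n k).
Let H := centered_norm D Z n q.

Lemma H_seminorm : seminorm H.
Proof.
have h1 := seminorm_comp (lin q) DS; have h2 := seminorm_comp (lin u) ZS.
split=> [a b|a b]; rewrite /H /centered_norm -/u.
  by have := sn_tri h1 a b; have := sn_tri h2 a b; rewrite /=; lra.
by have := snZ h1 a b; have := snZ h2 a b; rewrite /= => -> ->; rewrite mulrDr.
Qed.

(** In the [D]-part, a multiplier constant on each interval; in the [Z]-part, [block_collapse],
    which kills the blocks outside [A] because the [u k] have mass 0. *)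
Lemma H_suppression p (A : pred nat) : H (coefmul (fun i => (A i)%:R) p) <= H p.
Proof.
have [hn hs] := hq; apply: lerD.
  have [k [_ _ k2]] := owner hn.
  have -> : lin q (coefmul (fun i => (A i)%:R) p) = coefmul (fun i => (A (k i))%:R) (lin q p).
    rewrite lin_coefmul lin_comp; apply: eq_lin => l _ /=.
    apply/polyP => t; rewrite coefZ coef_coefmul.
    by have [->|/hs/k2->] := eqVneq (q l)`_t 0; rewrite ?mulr0.
  by apply: (geoD_coefmul G) => i; exact: nat_of_bool_01.
have [k [nk k2]] := block_collapse A hn.
apply: le_trans (geoZ_merge G _ nk); rewrite lin_coefmul lin_comp.
rewrite le_eqVlt (eq_lin (y' := collapse k \o u)) ?eqxx // => l _ /=.
have us i : (u l)`_i != 0 -> (n l <= i < n l.+1)%N.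
  rewrite /u coefB coefZ coefXn; case: (eqVneq i (n l)) => [-> _|_].
    by rewrite leqnn hn.
  by rewrite mulr0 subr0; exact: hs.
case Al : (A l).
  rewrite scale1r -[LHS]lin_id; apply: eq_lin => i /us/k2; by rewrite Al => ->.
rewrite (collapse_const (l := n l)); last by move=> i /us/k2; rewrite Al.
by rewrite /u hornerD hornerN hornerZ hornerXn expr1n mulr1 subrr !scale0r.
Qed.

(** Centering subtracts the masses at the left ends, which [Z_point_le] controls. *)
Lemma H_le_6E p : H p <= 6 * E (lin q p).
Proof.
have h1 := geoDE G (lin q p); have h2 := geoZE G (lin q p).
have h3 := Z_point_le G p hq.
have : Z (lin u p) <= Z (lin q p) + Z (lin (fun k => s k *: 'X^(n k)) p).
  by rewrite /u linBl; exact: (sn_triB ZS).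
have := sn_ge0 ES (lin q p); rewrite /H /centered_norm -/u; lra.
Qed.

Lemma E_le_H p : E (lin q p) <= H p + Z (lin (fun k => s k *: 'X^(n k)) p).
Proof.
apply: le_trans (geoEDZ G _) _; rewrite /H /centered_norm -addrA lerD2l.
apply: le_trans (sn_ler_sub ZS _ (lin (fun k => s k *: 'X^(n k)) p)) _.
by rewrite -linBl addrC.
Qed.

Lemma Z_point_sum_le (w : nat -> R) (m : nat -> nat) p :
  Z (lin (fun k => w k *: 'X^(m k)) p) <= \sum_(k < size p) `|p`_k| * (`|w k| * Z 1).
Proof.
apply: le_trans (sn_lin ZS _ _) _; apply: ler_sum => k _.
by rewrite (snZ ZS) ler_wpM2l // ler_wpM2l // (Z_X G).
Qed.

(* The masses being summable, [E] is equivalent to [H] on the blocks. *)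
Lemma null_masses_unconditional (m : R) : 0 < m -> (forall k, m <= E (q k)) ->
  (forall k, `|s k| * Z 1 <= m / 2 * 2^-1 ^+ k) ->
  forall p (A : pred nat),
    E (lin q (coefmul (fun i => (A i)%:R) p)) <= 18 * E (lin q p).
Proof.
move=> m0 hm hs.
(* The mass takes away at most half of the lower bound [m]. *)
have hX k : m / 2 <= H 'X^k.
  have := E_le_H 'X^k; rewrite !linX (snZ ZS) => h1.
  have h2 := hm k; have h3 := hs k.
  have h4 : `|s k| * Z 'X^(n k) <= `|s k| * Z 1 by rewrite ler_wpM2l // (Z_X G).
  have h5 : m / 2 * 2^-1 ^+ k <= m / 2 * 1.
    by rewrite ler_wpM2l ?divr_ge0 ?(ltW m0) // exprn_ile1 ?invr_ge0 // invf_le1 // ler1n.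
  lra.
have hcoef (p : {poly R}) k : `|p`_k| <= 2 / m * H p.
  rewrite mulrAC ler_pdivlMr // [2 * _]mulrC -ler_pdivrMr // -mulrA.
  apply: le_trans (ler_wpM2l _ (hX k)) _ => //.
  rewrite -(snZ H_seminorm); apply: le_trans (H_suppression p (pred1 k)).
  rewrite le_eqVlt; apply/orP; left; apply/eqP; congr H; apply/polyP => i.
  rewrite coefZ coefXn coef_coefmul /=.
  by case: eqP => [->|_]; rewrite ?mulr1 ?mul1r ?mulr0 ?mul0r.
(* One [H p] comes from [E_le_H] and [2 * (m / 2) * (2 / m) = 2] more from the masses; with
   [H_le_6E] this makes 18. *)
have h3 p : E (lin q p) <= 3 * H p.
  apply: le_trans (E_le_H p) _; rewrite -/(H p).
  have := Z_point_sum_le s n p.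
  have m20 : 0 <= m / 2 by rewrite divr_ge0 // ltW.
  have := @geometric_sum _ p (fun k => `|s k| * Z 1) _ _ m20 (hcoef p) hs.
  have -> : 2 * (m / 2) * (2 / m * H p) = 2 * H p by field; rewrite gt_eqF.
  lra.
move=> p A; apply: le_trans (h3 _) _.
have := H_suppression p A; have := H_le_6E p; rewrite -/(H _) -/(H _); lra.
Qed.

(** The lower bound on convex combinations and [H_suppression] make [H], hence [E] on the blocks,
    dominate the l_1 norm, which in turn bounds [E] through [M]. *)
Lemma l1_unconditional (delta M : R) : 0 < delta -> (forall k, E (q k) <= M) ->
  (forall r, convex_poly r -> delta <= H r) ->
  forall p (A : pred nat),
    E (lin q (coefmul (fun i => (A i)%:R) p)) <= M * (12 / delta) * E (lin q p).
Proof.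
move=> d0 hM hd p A.
have M0 : 0 <= M by apply: le_trans (hM 0%N); exact: (sn_ge0 ES).
have pos (r : {poly R}) : (forall i, 0 <= r`_i) -> delta * r.[1] <= H r.
  move=> r0; have r1 : 0 <= r.[1] by rewrite horner1_lin sumr_ge0.
  have [->|r1n] := eqVneq r.[1] 0; first by rewrite mulr0 (sn_ge0 H_seminorm).
  have r1p : 0 < r.[1] by rewrite lt_def r1n.
  have := hd (r.[1]^-1 *: r); rewrite (snZ H_seminorm) ger0_norm ?invr_ge0 //.
  rewrite [_^-1 * _]mulrC ler_pdivlMr //; apply; split=> [i|].
    by rewrite coefZ mulr_ge0 ?invr_ge0.
  by rewrite hornerZ mulVf.
have := suppression_l1 H_suppression pos (snN H_seminorm) p => hl.
have h6 := H_le_6E p; rewrite -/(H p) in h6.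
rewrite lin_coefmul; apply: le_trans (sn_lin ES _ _) _.
apply: le_trans (_ : M * \sum_(i < size p) `|p`_i| <= _).
  rewrite mulr_sumr; apply: ler_sum => i _; rewrite mulrC ler_wpM2r //.
  rewrite (snZ ES); apply: le_trans (hM i); rewrite -[leRHS]mul1r ler_wpM2r ?(sn_ge0 ES) //.
  by case: (A i); rewrite ?normr1 ?normr0.
rewrite -mulrA ler_wpM2l // mulrAC ler_pdivlMr // mulrC; lra.
Qed.

(** Up to summable errors, the combined blocks are [l] times convex blocks of unit vectors. The
    bound on [eps] keeps the error due to the masses below half of the main term. *)
Lemma nonzero_masses_comparable (l eps B : R) m r : l != 0 -> 0 < eps -> 0 < B ->
  (forall (p : {poly R}) i, `|p`_i| <= B * Z p) ->
  eps * Z 1 * (4 * B) <= `|l| ->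
  (forall k, `|s k - l| <= eps * 2^-1 ^+ k) ->
  iblock m r -> (forall j, convex_poly (r j)) -> (forall j, H (r j) <= 2^-1 ^+ j) ->
  comparable_norms (fun p => E (lin (fun j => lin q (r j)) p)) Z.
Proof.
move=> l0 eps0 B0 hB heps hs hr cr hH.
have [hm rs] := hr.
pose y j := lin q (r j).
have hy : iblock (n \o m) y by exact: iblock_lin.
have Z10 : 0 <= Z 1 by exact: (sn_ge0 ZS).
have h2 k j : (j <= k)%N -> 2^-1 ^+ k <= 2^-1 ^+ j :> R.
  by move=> jk; rewrite ler_wiXn2l ?invr_ge0 // invf_le1 // ler1n.
have hsj j k : (r j)`_k != 0 -> `|s k - l| <= eps * 2^-1 ^+ j.
  move=> /rs/andP[mk _]; apply: le_trans (hs k) _; rewrite ler_wpM2l ?(ltW eps0) // h2 //.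
  exact: leq_trans (incr_ge hm j) mk.
have hsum j c : 0 <= c -> \sum_(k < size (r j)) `|(r j)`_k| * (`|s k - l| * c) <= eps * 2^-1 ^+ j * c.
  move=> c0; rewrite -[leRHS]mul1r -[X in _ <= X * _](cr j).2 horner1_lin mulr_suml.
  apply: ler_sum => k _; rewrite ger0_norm ?(cr j).1 //.
  have [->|/hsj h] := eqVneq (r j)`_k 0; first by rewrite !mul0r.
  by rewrite ler_wpM2l ?(cr j).1 // ler_wpM2r.
have y1 j : `|(y j).[1] - l| <= eps * 2^-1 ^+ j.
  have := hsum j 1 ler01; rewrite mulr1; apply: le_trans.
  have -> : (y j).[1] - l = \sum_(k < size (r j)) (r j)`_k * (s k - l).
    have lE : l = \sum_(k < size (r j)) (r j)`_k * l.
      by rewrite -mulr_suml -horner1_lin (cr j).2 mul1r.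
    rewrite horner_lin [X in _ - X]lE -sumrB.
    by apply: eq_bigr => k _; rewrite mulrBr.
  by apply: le_trans (ler_norm_sum _ _ _) _; apply: ler_sum => k _; rewrite normrM mulr1.
have sumZ (w : nat -> R) (p : {poly R}) : (forall j, w j <= eps * Z 1 * 2^-1 ^+ j) ->
    \sum_(j < size p) `|p`_j| * w j <= 2 * (eps * Z 1) * (B * Z p).
  by move=> hw; apply: geometric_sum => //; rewrite mulr_ge0 // ltW.
apply: (@comparable_normsI _ _ _ (2 * B + `|l| + 2 * (eps * Z 1) * B) (2 / `|l|)) => p;
  rewrite ?(sn_ge0 ES) ?(sn_ge0 ZS) //.
  apply: le_trans (geoEDZ G _) _.
  (* Each block splits into its centered part, the limit mass [l] at its left end, and the deviation
     of its mass from [l]. *)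
  pose v1 j := lin u (r j).
  pose v2 j := lin (fun k => 'X^(n k)) (r j) : {poly R}.
  pose v3 j := lin (fun k => (s k - l) *: 'X^(n k)) (r j).
  have yE : lin y p = lin v1 p + (l *: lin v2 p + lin v3 p).
    rewrite -linZl -!linDl; apply: eq_lin => j _.
    rewrite /y /v1 /v2 /v3 -linZl -!linDl; apply: eq_lin => k _.
    by rewrite scalerBl [l *: _ + _]addrC subrK subrK.
  have hv1 : D (lin y p) + Z (lin v1 p) <= 2 * B * Z p.
    apply: le_trans (lerD (sn_lin DS _ _) (sn_lin ZS _ _)) _.
    rewrite -big_split /=; have := @geometric_sum _ p (fun j => H (r j)) _ 1 ler01 (hB p).
    rewrite mulr1 mulrA => h; apply: le_trans (h _); last by move=> j; rewrite mul1r.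
    by apply: ler_sum => j _; rewrite -mulrDr.
  have hv2 : Z (lin v2 p) <= Z p.
    apply: le_trans (Z_convex G p hr cr); rewrite -(lin_comp (collapse n) r).
    by apply: (geoZ_merge G) => i j; apply: incr_le; case: hq.
  have hv3 : Z (lin v3 p) <= 2 * (eps * Z 1) * (B * Z p).
    apply: le_trans (sn_lin ZS _ _) _; apply: (sumZ (fun j => Z (v3 j))) => j.
    by apply: le_trans (Z_point_sum_le _ _ _) _; rewrite mulrAC; exact: hsum.
  rewrite yE in hv1 *; have := sn_tri ZS (lin v1 p) (l *: lin v2 p + lin v3 p).
  have := sn_tri ZS (l *: lin v2 p) (lin v3 p).
  have := ler_wpM2l (normr_ge0 l) hv2; rewrite (snZ ZS); lra.
have hE : Z (lin (fun j => (y j).[1] *: 'X^j) p) <= E (lin y p).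
  by apply: le_trans (geoZE G _); exact: (Z_mass_le G p hy).
have hdiff : Z (lin (fun j => (l - (y j).[1]) *: 'X^j) p) <= 2 * (eps * Z 1) * (B * Z p).
  apply: le_trans (Z_point_sum_le _ id _) _; apply: (sumZ (fun j => `|l - (y j).[1]| * Z 1)) => j.
  by rewrite distrC mulrAC ler_wpM2r.
have hl : `|l| * Z p <= E (lin y p) + 2 * (eps * Z 1) * (B * Z p).
  rewrite -(snZ ZS); have -> : l *: p = lin (fun j => (y j).[1] *: 'X^j) p
      + lin (fun j => (l - (y j).[1]) *: 'X^j) p.
    rewrite -linDl -[p in LHS]lin_id -linZl; apply: eq_lin => j _.
    by rewrite -scalerDl addrC subrK.
  by apply: le_trans (sn_tri ZS _ _) _; exact: lerD.
rewrite mulrAC ler_pdivlMr ?normr_gt0 //.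
have := ler_wpM2r (sn_ge0 ZS p) heps; rewrite -/y; lra.
Qed.

End Signed.
End Sequences.

(** * The dichotomy for seminormalized blocks *)

Section Dichotomy.
Variables (R : realType) (E D Z : {poly R} -> R).
Hypothesis G : geometry E D Z.

Let ES := geoE G.
Let DS := geoD G.
Let ZS := geoZ G.

Lemma convex_X k : convex_poly ('X^k : {poly R}).
Proof. by split=> [i|]; rewrite ?coefXn // hornerXn expr1n. Qed.

Lemma iblock_X f : (forall i, (f i < f i.+1)%N) -> iblock f (fun k => 'X^(f k) : {poly R}).
Proof.
move=> hf; split=> // k i; rewrite coefXn.
by case: (eqVneq i (f k)) => [->|]; rewrite ?eqxx // leqnn hf.
Qed.

Lemma block_dichotomy n q (m M : R) : iblock n q -> 0 < m -> (forall k, m <= E (q k) <= M) ->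
  (exists f, (forall i, (f i < f i.+1)%N) /\ exists K : R, forall p (A : pred nat),
     E (lin (q \o f) (coefmul (fun i => (A i)%:R) p)) <= K * E (lin (q \o f) p)) \/
  (exists l r, [/\ iblock l r, forall j, convex_poly (r j) &
     comparable_norms (fun p => E (lin (fun j => lin q (r j)) p)) Z]).
Proof.
move=> hq m0 hmM.
have [B B0 hB] := geoZ_coef G.
have Z1 : 0 < Z 1.
  by have := hB 1 0%N; rewrite coef1 /= normr1 => h; rewrite -(pmulr_rgt0 _ B0); lra.
pose s k := (q k).[1].
(* Merging a whole block to index 0 leaves only its mass. *)
have hsM k : `|s k| <= M / Z 1.
  rewrite ler_pdivlMr // -(snZ ZS).
  have := geoZ_merge G (q k) (k := fun=> 0%N).
  rewrite (collapse_const (l := 0%N)) // expr0 -/(s k) => h.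
  apply: le_trans (h _) _ => //; apply: le_trans (geoZE G _) _.
  by case/andP: (hmM k).
have [l hl] := bounded_cluster hsM.
(* The two values are those required by [null_masses_unconditional] and
   [nonzero_masses_comparable]. *)
pose eps := if l == 0 then m / 2 / Z 1 else `|l| / (Z 1 * (4 * B)).
have eps0 : 0 < eps.
  rewrite /eps; case: eqVneq => l0; first by rewrite !divr_gt0.
  by rewrite divr_gt0 ?normr_gt0 // !mulr_gt0.
have [|f [hf hP]] := @subsequence_choice (fun j k => `|s k - l| <= eps * 2^-1 ^+ j).
  move=> N j; have e0 : 0 < eps * 2^-1 ^+ j by rewrite mulr_gt0 // exprn_gt0 // invr_gt0.
  by have [k [Nk hk]] := hl _ e0 N; exists k; split=> //; exact: ltW.
have hqf := iblock_sub hq hf.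
have [l0|l0] := eqVneq l 0.
  left; exists f; split=> //; exists 18.
  apply: (null_masses_unconditional G hqf m0) => [k|k] /=; first by case/andP: (hmM (f k)).
  have := hP k; rewrite l0 subr0 /eps l0 eqxx -(ler_pM2r Z1) => h.
  by apply: le_trans h _; rewrite mulrAC divfK // gt_eqF.
pose H := centered_norm D Z (n \o f) (q \o f).
have [hsmall|hlarge] := pselect (forall N j, exists r : {poly R},
    (forall i, r`_i != 0 -> (N <= i)%N) /\ (convex_poly r /\ H r <= 2^-1 ^+ j)).
  have [l' [r [hr hPr]]] := block_choice hsmall.
  (* [r j] combines the blocks of the subsequence; collapsing along [f] expresses this in the
     original blocks. *)
  right; exists (f \o l'), (fun j => collapse f (r j)); split.
  - by apply: iblock_lin => //; exact: iblock_X.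
  - by move=> j; apply: convex_lin; [case: (hPr j)|move=> k; exact: convex_X].
  have := @nonzero_masses_comparable _ _ _ _ G _ _ hqf l eps B l' r l0 eps0 B0 hB _ hP hr
    (fun j => (hPr j).1) (fun j => (hPr j).2).
  have -> : (fun j => lin (q \o f) (r j)) = (fun j => lin q (collapse f (r j))).
    by apply/funext => j; rewrite lin_collapse.
  by apply; rewrite /eps (negbTE l0) -mulrA divfK // gt_eqF // !mulr_gt0.
have [N [j hN]] : exists N j, forall r : {poly R}, (forall i, r`_i != 0 -> (N <= i)%N) ->
    convex_poly r -> 2^-1 ^+ j <= H r.
  apply: contrapT => hno; apply: hlarge => N j; apply: contrapT => hno2; apply: hno.
  exists N, j => r hr cr; rewrite leNgt; apply/negP => h; apply: hno2.
  by exists r; do 2?split=> //; exact: ltW.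
(* The lower bound on [H] holds for combinations supported beyond [N], so the first [N] terms are
   dropped. *)
left; pose g k := (k + N)%N; have hg i : (g i < g i.+1)%N by rewrite /g addSn.
exists (f \o g); split=> [i|]; first by apply: incr_lt hf _ _ _.
have hqg := iblock_sub hqf hg.
exists (M * (12 / 2^-1 ^+ j)).
apply: (l1_unconditional G hqg) => [|k|r cr]; first by rewrite exprn_gt0 // invr_gt0.
  by case/andP: (hmM (f (g k))).
have := hN (collapse g r) _ (convex_lin cr (fun k => convex_X (g k))).
rewrite /H /centered_norm !lin_collapse; apply=> i; rewrite coef_collapse.
apply: contraNT; rewrite -ltnNge => iN; rewrite big_pred0 // => k.
by apply/negbTE; rewrite /g neq_ltn (leq_trans iN) ?orbT // leq_addl.
Qed.

End Dichotomy.

Lemma small_eq0 (R : realType) (V : normedModType R) (v : V) (K : R) :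
  (forall eps, 0 < eps -> `|v| <= K * eps) -> v = 0.
Proof.
move=> h; apply/eqP; rewrite -normr_le0; apply: (@ler_addinv _ _ _ K) => N N0.
by rewrite add0r; apply: h; rewrite invr_gt0 ltr0n.
Qed.

Lemma lipschitz_continuous (R : realType) (V W : normedModType R) (f : V -> W) (C : R) :
  (forall u v, `|f u - f v| <= C * `|u - v|) -> continuous f.
Proof.
move=> hC v; apply/cvgrPdist_lt => /= eps eps0.
have C1 : 0 < `|C| + 1 by rewrite ltr_wpDl.
apply/nbhs_ballP; exists (eps / (`|C| + 1)); first exact: divr_gt0.
move=> w; rewrite -ball_normE /= ltr_pdivlMr // mulrC => h.
apply: le_lt_trans (hC _ _) _; apply: le_lt_trans h.
by rewrite ler_wpM2r //; have := ler_norm C; lra.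
Qed.

(** * Bounded linear extension from a dense span *)

Section Extension.
Variables (R : realType) (V : normedModType R) (W : completeNormedModType R).
Variables (x : nat -> V) (y : nat -> W) (C : R).
Hypotheses (C0 : 0 <= C) (hC : forall p, `|lin y p| <= C * `|lin x p|).
Hypothesis dense : closed_span x = setT.

(** [T v] is the limit along approximants of [v]. The single estimate against every [p] contains
    both [T (lin x p) = lin y p] and, at [p = 0], the bound on [T]. *)
Lemma linear_extension : exists T : {linear V -> W},
  forall v p, `|T v - lin y p| <= C * `|v - lin x p|.
Proof.
have /choice[P hP] : forall vk : V * nat, exists p, `|vk.1 - lin x p| < vk.2.+1%:R^-1.
  move=> [v k]; have : closed_span x v by rewrite dense.
  by move/closed_spanP; apply; rewrite invr_gt0.
have hCB p q v : `|lin y p - lin y q| <= C * (`|v - lin x p| + `|v - lin x q|).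
  rewrite -linearB; apply: le_trans (hC _) _; rewrite ler_wpM2l //.
  have -> : lin x (p - q) = (v - lin x q) - (v - lin x p).
    by rewrite linearB /= opprB [RHS]addrC addrA subrK.
  by rewrite [leRHS]addrC; exact: ler_normB.
have cv v : cvgn (fun k => lin y (P (v, k))).
  apply: (@cvgn_rate _ _ _ C) => k l; apply: le_trans (hCB _ _ v) _.
  by rewrite ler_wpM2l // lerD //; apply: ltW; [exact: (hP (v, k))|exact: (hP (v, l))].
have /choice[T0 hT0] : forall v, exists w : W, (fun k => lin y (P (v, k))) @ \oo --> w.
  by move=> v; exact/cvg_ex.
have hT v p : `|T0 v - lin y p| <= C * `|v - lin x p|.
  have hl : (fun k => `|lin y (P (v, k)) - lin y p|) @ \oo --> (`|T0 v - lin y p| : R).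
    by apply: cvg_norm; apply: cvgB (hT0 v) (cvg_cst _).
  apply: (cvgn_le_addinv (K := C) _ hl) => N N0.
  apply: le_trans (hCB _ _ v) _; rewrite mulrDr addrC lerD2l ler_wpM2l //.
  apply: le_trans (ltW (hP (v, N))) _.
  by rewrite lef_pV2 ?posrE ?ltr0n // ler_nat.
have approx v eps : 0 < eps -> exists p, `|v - lin x p| < eps.
  move=> eps0; have : closed_span x v by rewrite dense.
    by move/closed_spanP; apply.
have T0_lin : linear T0.
  move=> a v w; apply/eqP; rewrite -subr_eq0; apply/eqP.
  apply: (@small_eq0 _ _ _ (2 * C * (`|a| + 1))) => eps eps0.
  have [p hp] := approx v eps eps0; have [q hq] := approx w eps eps0.
  have h1 := hT (a *: v + w) (a *: p + q); have h2 := hT v p; have h3 := hT w q.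
  have e1 : `|a *: v + w - lin x (a *: p + q)| <= `|a| * eps + eps.
    rewrite linearP /= opprD addrACA -scalerBr; apply: le_trans (ler_normD _ _) _.
    by rewrite normrZ lerD ?(ltW hq) // ler_wpM2l // ltW.
  have -> : T0 (a *: v + w) - (a *: T0 v + T0 w) =
      (T0 (a *: v + w) - lin y (a *: p + q)) -
      (a *: (T0 v - lin y p) + (T0 w - lin y q)).
    have -> : a *: (T0 v - lin y p) + (T0 w - lin y q) =
        a *: T0 v + T0 w - lin y (a *: p + q).
      by rewrite linearP /= scalerBr addrACA opprD.
    by rewrite [in RHS]opprB addrA subrK.
  apply: le_trans (ler_normB _ _) _.
  apply: le_trans (lerD (lexx _) (ler_normD _ _)) _; rewrite normrZ.
  have h2' : `|a| * `|T0 v - lin y p| <= `|a| * (C * eps).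
    by rewrite ler_wpM2l // (le_trans h2) // ler_wpM2l // ltW.
  have h3' : `|T0 w - lin y q| <= C * eps by rewrite (le_trans h3) // ler_wpM2l // ltW.
  have h1' := le_trans h1 (ler_wpM2l C0 e1).
  lra.
pose T : {linear V -> W} := HB.pack T0 (GRing.isLinear.Build R V W *:%R T0 T0_lin).
by exists T.
Qed.

End Extension.

(** * Unconditionality from uniformly bounded coordinate projections *)

Section Unconditional.
Variables (R : realType) (V : completeNormedModType R) (x : nat -> V) (K : R).
Hypothesis x_neq0 : forall i, x i != 0.
Hypothesis suppr : forall p (A : pred nat),
  `|lin x (coefmul (fun i => (A i)%:R) p)| <= K * `|lin x p|.

Let K0 : 0 <= K.
Proof.
have h := suppr 1 xpredT; have h1 := le_trans (normr_ge0 _) h.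
by move: h1; rewrite linC pmulr_lge0 // normr_gt0.
Qed.

Lemma coef_bound (p : {poly R}) i : `|p`_i| * `|x i| <= K * `|lin x p|.
Proof.
rewrite -normrZ; have := suppr p (pred1 i).
suff -> : coefmul (fun j => (pred1 i j)%:R) p = p`_i *: 'X^i by rewrite linearZ /= linX.
apply/polyP => j; rewrite coef_coefmul coefZ coefXn /=.
by case: eqP => [->|_]; rewrite ?mulr1 ?mul1r ?mulr0 ?mul0r.
Qed.

Lemma series_lin (a : nat -> R) n : series (fun i => a i *: x i) n = lin x (\poly_(i < n) a i).
Proof. by rewrite lin_poly /series /= big_mkord. Qed.

Lemma expansion_unique a b v : is_expansion x a v -> is_expansion x b v -> a = b.
Proof.
move=> ha hb; apply/funext => i; apply/eqP; rewrite -subr_eq0 -normr_le0.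
have h : (fun n => `|series (fun i => a i *: x i) n - series (fun i => b i *: x i) n|) @ \oo --> (0 : R).
  rewrite -[X in _ --> X](normr0 V) -(subrr v); apply: cvg_norm; exact: cvgB.
have hK : (fun n => K * `|series (fun i => a i *: x i) n - series (fun i => b i *: x i) n|) @ \oo
    --> (0 : R).
  by rewrite -[X in _ --> X](mulr0 K); exact: cvgMl_tmp.
have xi : 0 < `|x i| by rewrite normr_gt0.
rewrite -(pmulr_lle0 _ xi) mulrC -(cvg_lim _ hK) //.
apply: limr_ge; first by apply/cvg_ex; exists 0.
exists i.+1 => // n /= ni.
rewrite !series_lin -linearB /=; apply: le_trans (coef_bound _ i).
by rewrite coefB !coef_poly ni mulrC.
Qed.

(** The coefficients of the approximants [P k] converge. Truncation being bounded by [K], the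
    partial sums of the limit stay within [K / k.+1] of the truncations of [P k], uniformly in [n];
    for [n] at least the size of [P k], truncating changes nothing. *)
Lemma expansion_exists v : closed_span x v -> exists a, is_expansion x a v.
Proof.
move=> /closed_spanP hv.
have /choice[P hP] : forall k, exists p, `|v - lin x p| < k.+1%:R^-1.
  by move=> k; apply: hv; rewrite invr_gt0.
have dist k l : `|lin x (P k - P l)| <= k.+1%:R^-1 + l.+1%:R^-1.
  have -> : lin x (P k - P l) = (v - lin x (P l)) - (v - lin x (P k)).
    by rewrite linearB /= opprB [RHS]addrC addrA subrK.
  by rewrite [leRHS]addrC; apply: le_trans (ler_normB _ _) _; apply: lerD; exact: ltW.
have cv i : cvgn (fun k => (P k)`_i : R^o).
  have xi : 0 < `|x i| by rewrite normr_gt0.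
  apply: (@cvgn_rate _ _ _ (K / `|x i|)) => k l.
  rewrite mulrAC ler_pdivlMr // -coefB; apply: le_trans (coef_bound _ i) _.
  by rewrite ler_wpM2l.
have /choice[a ha] : forall i, exists l : R, (fun k => (P k)`_i) @ \oo --> l.
  by move=> i; exact/cvg_ex.
exists a.
have hpart n : (fun l => lin x (\poly_(i < n) (P l)`_i)) @ \oo --> series (fun i => a i *: x i) n.
  have -> : (fun l => lin x (\poly_(i < n) (P l)`_i)) = (fun l => lincomb x n (fun i => (P l)`_i)).
    by apply/funext => l; rewrite lin_poly.
  rewrite series_lin lin_poly; elim: n => [|n IH].
    by rewrite /lincomb big_ord0; under eq_fun do rewrite big_ord0; exact: cvg_cst.
  have recr (c : nat -> R) : lincomb x n.+1 c = lincomb x n c + c n *: x n.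
    by rewrite /lincomb big_ord_recr.
  by rewrite recr; under eq_fun do rewrite recr; apply: cvgD IH _; exact: cvgZr_tmp.
have trunc n (p : {poly R}) : \poly_(i < n) p`_i = coefmul (fun i => (i < n)%N%:R) p.
  apply/polyP => i; rewrite coef_poly coef_coefmul.
  by case: ltnP; rewrite ?mul1r ?mul0r.
have bound n k : `|series (fun i => a i *: x i) n - lin x (\poly_(i < n) (P k)`_i)| <= K / k.+1%:R.
  have hl : (fun l => `|lin x (\poly_(i < n) (P l)`_i) - lin x (\poly_(i < n) (P k)`_i)|) @ \oo
     --> (`|series (fun i => a i *: x i) n - lin x (\poly_(i < n) (P k)`_i)| : R).
    by apply: cvg_norm; apply: cvgB (hpart n) (cvg_cst _).
  apply: (cvgn_le_addinv (K := K) _ hl) => N N0.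
  rewrite !trunc -linearB -linearB; apply: le_trans (suppr _ _) _.
  rewrite -mulrDr ler_wpM2l // (le_trans (dist _ _)) // addrC lerD2l.
  by rewrite lef_pV2 ?posrE ?ltr0n // ler_nat.
apply/cvgrPdist_lt => /= eps eps0.
have K1 : 0 < K + 1 by rewrite ltr_wpDl.
have [k hk] := inv_nat_lt (divr_gt0 eps0 K1).
exists (size (P k)) => // n /= hn.
have hPk : \poly_(i < n) (P k)`_i = P k.
  by apply/polyP => i; rewrite coef_poly; case: ltnP => // ni; rewrite nth_default // (leq_trans hn).
have := bound n k; rewrite hPk => h1; have h2 := hP k.
have h3 := hk k (leqnn k); rewrite ltr_pdivlMr // in h3.
have -> : v - series (fun i => a i *: x i) n = (v - lin x (P k)) -
    (series (fun i => a i *: x i) n - lin x (P k)).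
  by rewrite opprB addrA subrK.
apply: le_lt_trans (ler_normB _ _) _; apply: le_lt_trans h3.
by rewrite mulrDr mulr1 addrC mulrC; apply: lerD => //; exact: ltW.
Qed.

Lemma sum_pick n (F : nat -> R) t : \sum_(i < n) F i * (i == t :> nat)%:R = if (t < n)%N then F t else 0.
Proof.
case: ltnP => tn; last by rewrite big1 // => i _; rewrite ltn_eqF ?mulr0 // (leq_trans (ltn_ord i)).
rewrite (bigD1 (Ordinal tn)) //= eqxx mulr1 big1 ?addr0 // => i it.
by case: eqP => [e|_]; rewrite ?mulr0 //; case/eqP: it; exact: val_inj.
Qed.

(** Cauchy criterion: a late segment of the rearranged series is a coordinate projection of a late
    segment of the original one. *)
Lemma rearrangement_cvg a v s : is_expansion x a v -> bijective s ->
  cvgn (series (fun i => a (s i) *: x (s i))).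
Proof.
move=> hv [g sg gs]; apply: cauchy_cvg; apply/cauchy_seriesP => eps eps0.
have : cauchy (series (fun i => a i *: x i) @ \oo) by apply: cvg_cauchy; apply/cvg_ex; exists v.
have K1 : 0 < K + 1 by rewrite ltr_wpDl.
move=> /cauchy_seriesP/(_ _ (divr_gt0 eps0 K1)) [[A1 A2] /= [[N1 _ hN1] [N2 _ hN2]] hA].
(* Every index below [N0] occurs in the rearrangement before position [M]. *)
pose N0 := maxn N1 N2; pose M := \max_(j < N0) (g j).+1.
have hM i : (M <= i)%N -> (N0 <= s i)%N.
  move=> Mi; rewrite leqNgt; apply/negP => h.
  have := leq_bigmax (F := fun j : 'I_N0 => (g j).+1) (Ordinal h).
  by rewrite /= sg => h'; have := leq_trans h' Mi; rewrite ltnn.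
exists ([set i | M <= i]%N, [set i | M <= i]%N); first by split; exists M.
move=> [m n] /= [Mm Mn].
pose Q : {poly R} := \sum_(i < n) ((m <= i)%N%:R * a (s i)) *: 'X^(s i).
have cQ j : Q`_j = if (m <= g j < n)%N then a j else 0.
  rewrite coef_sum (eq_bigr (fun i : 'I_n => (m <= i)%N%:R * a (s i) * (i == g j :> nat)%:R)).
    rewrite (sum_pick n (fun i => (m <= i)%N%:R * a (s i))) gs andbC.
    by case: (ltnP (g j) n); case: (leqP m (g j)) => _ _ //=; rewrite ?mul1r ?mul0r.
  move=> i _; rewrite coefZ coefXn; congr (_ * _%:R); congr nat_of_bool.
  by apply/eqP/eqP => [->|->]; rewrite ?sg ?gs.
have hQ : lin x Q = \sum_(m <= i < n) a (s i) *: x (s i).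
  rewrite linear_sum big_geq_mkord [RHS]big_mkcond; apply: eq_bigr => i _ /=.
  by rewrite linearZ /= linX; case: (leqP m i); rewrite ?mul1r // mul0r scale0r.
pose T := maxn (size Q) N0.
pose p : {poly R} := \poly_(j < T) (if (N0 <= j)%N then a j else 0).
have hp : lin x p = \sum_(N0 <= j < T) a j *: x j.
  rewrite lin_poly big_geq_mkord [RHS]big_mkcond; apply: eq_bigr => j _ /=.
  by case: ifP; rewrite ?scale0r.
have Qp : Q = coefmul (fun j => (Q`_j != 0)%:R) p.
  apply/polyP => j; rewrite coef_coefmul coef_poly.
  have [->|Qj] := eqVneq Q`_j 0; first by rewrite mul0r.
  have jT : (j < T)%N.
    by rewrite leq_max ltnNge; apply/orP; left; apply: contra Qj => h; rewrite nth_default.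
  rewrite jT mul1r; move: Qj; rewrite cQ; case: ifP => [/andP[mg _] _|]; last by rewrite eqxx.
  by rewrite -[j]gs hM // (leq_trans Mm).
rewrite -hQ Qp; apply: le_lt_trans (suppr _ _) _.
have := hA (N0, T); rewrite /= -hp => /(_ _).
move=> h; have {}h : `|lin x p| < eps / (K + 1).
  apply: h; split; [apply: hN1|apply: hN2]; rewrite /= ?leq_maxl //.
  by rewrite (leq_trans (leq_maxr N1 N2)) // leq_maxr.
rewrite ltr_pdivlMr // in h; apply: le_lt_trans h.
by rewrite mulrC ler_wpM2l //; lra.
Qed.

Lemma unconditional_of_suppression : unconditional_seq x.
Proof.
split; last by move=> a v hv s; exact: rearrangement_cvg hv.
split=> [i|v /expansion_exists[a ha]].
  by apply/closed_spanP => eps eps0; exists 'X^i; rewrite linX subrr normr0.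
by exists a; split=> // b; exact: expansion_unique.
Qed.

End Unconditional.

(** * Projections, isomorphisms and encodings of block sequences *)

Section Spaces.
Variable R : realType.

Lemma equivalent_seqP (V W : normedModType R) (x : nat -> V) (y : nat -> W) :
  equivalent_seq x y <-> comparable_norms (fun p => `|lin x p|) (fun p => `|lin y p|).
Proof.
split=> -[c [C [c0 C0 h]]]; exists c, C; split=> //; first by move=> p; exact: h.
by move=> n a; rewrite -!lin_poly.
Qed.

Lemma closed_span_basis (V : normedModType R) (e : nat -> V) :
  schauder_basis e -> closed_span e = setT.
Proof.
move=> [_ he]; apply/seteqP; split=> // v _; apply/closed_spanP => eps eps0.
have [a [ha _]] := he v I.
have [N _ hN] := cvgr_dist_lt _ _ ha _ eps0.
exists (\poly_(i < N) a i); have := hN N (leqnn N).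
by rewrite /= lin_poly /series /= big_mkord.
Qed.

(** The projection extends [e i |-> x (k i)]: it fixes [x j] because [q j] has mass 1 and [k] is
    constantly [j] on its support. *)
Lemma complemented_closed_span (V : completeNormedModType R) (e x : nat -> V)
    (k : nat -> nat) (q : nat -> {poly R}) (C : R) :
  closed_span e = setT -> 0 <= C ->
  (forall p, `|lin (x \o k) p| <= C * `|lin e p|) ->
  (forall j, x j = lin e (q j)) ->
  (forall j i, (q j)`_i != 0 -> k i = j) -> (forall j, (q j).[1] = 1) ->
  complemented (closed_span x).
Proof.
move=> dense C0 hC xq qk q1.
have [T hT] := linear_extension C0 hC dense.
have Te p : T (lin e p) = lin (x \o k) p.
  apply/eqP; rewrite -subr_eq0 -normr_le0; apply: le_trans (hT _ p) _.
  by rewrite subrr normr0 mulr0.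
have Tx p : T (lin x p) = lin x p.
  rewrite lin_comp; apply: eq_lin => j _ /=; rewrite [in LHS]xq Te.
  rewrite (eq_lin (y' := fun=> x j)) ?lin_const ?q1 ?scale1r // => i /qk /= ->//.
have Tb v : `|T v| <= C * `|v|.
  by have := hT v 0; rewrite !linear0 !addr0.
have fixT v : closed_span x v -> T v = v.
  move=> /closed_spanP hv; apply/eqP; rewrite -subr_eq0; apply/eqP.
  apply: (@small_eq0 _ _ _ (C + 1)) => eps eps0; have [p hp] := hv _ eps0.
  have -> : T v - v = T (v - lin x p) - (v - lin x p).
    by rewrite linearB /= Tx opprB addrA subrK.
  apply: le_trans (ler_normB _ _) _; rewrite mulrDl mul1r.
  apply: lerD (ltW hp); apply: le_trans (Tb _) _; rewrite ler_wpM2l //; exact: ltW.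
have imT v : closed_span x (T v).
  apply/closed_spanP => eps eps0; have C1 : 0 < C + 1 by lra.
  have : closed_span e v by rewrite dense.
  move=> /closed_spanP/(_ _ (divr_gt0 eps0 C1))[p hp].
  exists (collapse k p); rewrite lin_collapse; apply: le_lt_trans (hT v p) _.
  move: hp; rewrite ltr_pdivlMr // => h; apply: le_lt_trans h.
  by rewrite mulrC ler_wpM2l //; lra.
exists T; split.
- by apply: (@lipschitz_continuous _ _ _ _ C) => u v; rewrite -linearB.
- by move=> v; exact: fixT.
- by apply/seteqP; split=> [_ [v _ <-]//|v hv]; exists v => //; exact: fixT.
Qed.

(** The lower estimate makes the extension of [z i |-> x i] injective; with the completeness of [W],
    its range is closed. *)
Lemma isomorphic_closed_span (V W : completeNormedModType R) (x : nat -> V) (z : nat -> W) :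
  closed_span z = setT -> equivalent_seq x z -> isomorphic_to_subspace W (closed_span x).
Proof.
move=> dense /equivalent_seqP[c [C [c0 C0 h]]].
have hc p : `|lin x p| <= c^-1 * `|lin z p|.
  by rewrite mulrC ler_pdivlMr // mulrC; case/andP: (h p).
have hC p : `|lin z p| <= C * `|lin x p| by case/andP: (h p).
have c1 : 0 <= c^-1 by rewrite invr_ge0 ltW.
have [T hT] := linear_extension c1 hc dense.
have Tb v : `|T v| <= c^-1 * `|v|.
  by have := hT v 0; rewrite !linear0 !addr0.
have lower v : `|v| <= C * `|T v|.
  apply: (@ler_addinv _ _ _ (1 + C * c^-1)) => N N0.
  have N1 : 0 < N%:R^-1 :> R by rewrite invr_gt0 ltr0n.
  have : closed_span z v by rewrite dense.
  move=> /closed_spanP/(_ _ N1)[p hp].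
  have h1 : `|v| <= `|v - lin z p| + `|lin z p| by rewrite -{1}(subrK (lin z p) v) ler_normD.
  have h2 : `|lin x p| <= `|T v| + `|T v - lin x p|.
    by rewrite -{1}(subKr (T v) (lin x p)) ler_normB.
  have h3 := le_trans (hT v p) (ler_wpM2l c1 (ltW hp)).
  have h4 := ler_wpM2l (ltW C0) (le_trans h2 (lerD (lexx _) h3)).
  have h5 := hC p; rewrite mulrDl mul1r -mulrA; rewrite mulrDr in h4; lra.
have inj u v : T u = T v -> u = v.
  move=> uv; apply/eqP; rewrite -subr_eq0 -normr_le0; apply: le_trans (lower _) _.
  by rewrite linearB /= uv subrr normr0 mulr0.
have rangeT : range T = closed_span x.
  apply/seteqP; split=> [_ [v _ <-]|w /closed_spanP hw].
    apply/closed_spanP => eps eps0; have : closed_span z v by rewrite dense.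
    move=> /closed_spanP/(_ _ (mulr_gt0 c0 eps0))[p hp]; exists p.
    by apply: le_lt_trans (hT v p) _; rewrite mulrC ltr_pdivrMr // mulrC.
  have /choice[P hP] : forall k, exists p, `|w - lin x p| < k.+1%:R^-1.
    by move=> k; apply: hw; rewrite invr_gt0.
  have cv : cvgn (fun k => lin z (P k)).
    apply: (@cvgn_rate _ _ _ C) => k l; rewrite -linearB; apply: le_trans (hC _) _.
    rewrite ler_wpM2l ?(ltW C0) //.
    have -> : lin x (P k - P l) = (w - lin x (P l)) - (w - lin x (P k)).
      by rewrite linearB /= opprB [RHS]addrC addrA subrK.
    by rewrite [leRHS]addrC; apply: le_trans (ler_normB _ _) _; apply: lerD; exact: ltW.
  have [v hv] : exists v : W, (fun k => lin z (P k)) @ \oo --> v by exact/cvg_ex.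
  exists v => //.
  have hx1 : (fun k => lin x (P k)) @ \oo --> w.
    apply: (@cvgn_rate_lim _ _ _ _ 1) => k; rewrite mul1r; exact: ltW.
  have hx2 : (fun k => lin x (P k)) @ \oo --> T v.
    apply/cvgrPdist_lt => eps eps0.
    have [N _ hN] := cvgr_dist_lt _ _ hv _ (mulr_gt0 c0 eps0).
    exists N => // k /hN /= hk; apply: le_lt_trans (hT v (P k)) _.
    by rewrite mulrC ltr_pdivrMr // mulrC.
  exact: (cvg_unique (@norm_hausdorff _ V) hx2 hx1).
(* Outside the range the value of [S] is arbitrary. *)
have /choice[S hS] : forall w, exists v, closed_span x w -> T v = w.
  move=> w; have [/[dup]|] := pselect (closed_span x w); last by exists 0.
  by rewrite -{1}rangeT => -[v _ <-] _; exists v.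
exists T, S; split=> //.
- by apply: (@lipschitz_continuous _ _ _ _ c^-1) => u v; rewrite -linearB.
- by move=> v; apply: inj; apply: hS; rewrite -rangeT; exists v.
apply/subspace_continuousP => w hw; apply/cvgrPdist_lt => /= eps eps0.
apply/nbhs_ballP; exists (eps / C); first exact: divr_gt0.
move=> u; rewrite -ball_normE /= ltr_pdivlMr // mulrC => hu hu'.
by apply: le_lt_trans (lower _) _; rewrite linearB /= !hS.
Qed.

Lemma fset_poly_coef (F : {fset nat}) (c : nat -> R) j :
  (\sum_(i <- F) c i *: 'X^i : {poly R})`_j = if j \in F then c j else 0.
Proof.
rewrite coef_sum; case: ifP => jF.
  rewrite (bigD1_seq j) ?fset_uniq //= coefZ coefXn eqxx mulr1 big1 ?addr0 // => i ij.
  by rewrite coefZ coefXn eq_sym (negbTE ij) mulr0.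
rewrite big_seq big1 // => i iF; rewrite coefZ coefXn.
by case: eqP => [ji|]; rewrite ?mulr0 //; move: jF; rewrite ji iF.
Qed.

Lemma iblock_of_fset (F : nat -> {fset nat}) (c : nat -> R) : successive F ->
  (forall k, F k != fset0) ->
  exists n, iblock n (fun k => \sum_(i <- F k) c i *: 'X^i).
Proof.
move=> sF F0.
have /choice[n hn] : forall k, exists m, m \in F k /\ forall i, i \in F k -> (m <= i)%N.
  move=> k; have /fset0Pn ex := F0 k.
  by exists (ex_minn ex); case: ex_minnP.
exists n; split=> [k|k i]; first exact: (sF k k.+1 (leqnn _) _ _ (hn k).1 (hn k.+1).1).
rewrite fset_poly_coef; case: ifP => [iF _|]; last by rewrite eqxx.
by rewrite (hn k).2 //= (sF k k.+1 (leqnn _) _ _ iF (hn k.+1).1).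
Qed.

Lemma lin_fset (V : lmodType R) (e : nat -> V) (F : {fset nat}) (c : nat -> R) :
  lin e (\sum_(i <- F) c i *: 'X^i) = \sum_(i <- F) c i *: e i.
Proof. by rewrite linear_sum; apply: eq_bigr => i _; rewrite linearZ /= linX. Qed.

Lemma convex_block_seqE (V : lmodType R) (e x : nat -> V) : convex_block_seq e x ->
  exists n q, [/\ iblock n q, forall k, convex_poly (q k) & forall k, x k = lin e (q k)].
Proof.
move=> [F [c [[sF xE] c0 c1]]].
have F0 k : F k != fset0.
  by apply/eqP => Fk; have := c1 k; rewrite Fk big_seq_fset0 => /esym/eqP; rewrite oner_eq0.
have [n hn] := iblock_of_fset c sF F0.
exists n, (fun k => \sum_(i <- F k) c i *: 'X^i); split=> // k; last by rewrite lin_fset.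
split=> [i|].
  by rewrite fset_poly_coef; case: ifP => // /c0.
rewrite horner_sum -[RHS](c1 k); apply: eq_bigr => i _.
by rewrite hornerZ hornerXn expr1n mulr1.
Qed.

Lemma iblock_fset (m : nat -> nat) (r : nat -> {poly R}) : iblock m r ->
  (forall j, convex_poly (r j)) ->
  exists (F : nat -> {fset nat}) (c : nat -> R),
    [/\ forall (V : lmodType R) (x : nat -> V),
          is_convex_block_of x F c (fun j => lin x (r j)),
        forall j i, (i \in F j) = ((r j)`_i != 0) &
        forall j i, i \in F j -> c i = (r j)`_i].
Proof.
move=> [hm hr] cr.
pose s j := [seq i <- iota 0 (size (r j)) | (r j)`_i != 0].
pose F j := [fset i | i in s j]%fset.
have FE j i : (i \in F j) = ((r j)`_i != 0).
  rewrite in_fset /= mem_filter mem_iota /= add0n andbC.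
  by case: ltnP => // h; rewrite nth_default ?eqxx.
(* One coefficient function must serve all blocks. A block containing [i] has number at most [i],
   and the supports are disjoint, so at most one term is nonzero. *)
pose c i := \sum_(j < i.+1) (r j)`_i.
have cE j i : i \in F j -> c i = (r j)`_i.
  rewrite FE => ri; have /andP[h1 h2] := hr _ _ ri.
  have ji : (j < i.+1)%N by rewrite ltnS (leq_trans (incr_ge hm j)).
  rewrite /c (bigD1 (Ordinal ji)) //= big1 ?addr0 // => l lj; apply/eqP/negP => /negP/hr/andP[h3 h4].
  have [lj'|lj'|lj'] := ltngtP l j.
  - by have := incr_le hm lj'; lia.
  - by have := incr_le hm lj'; lia.
  - by case/eqP: lj; exact: val_inj.
have sumF (V : lmodType R) (G : nat -> V) j :
    \sum_(i <- F j) c i *: G i = lin G (r j).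
  rewrite big_seq_cond (eq_bigr (fun i => (r j)`_i *: G i)); last first.
    by move=> i /andP[iF _]; rewrite (cE j).
  rewrite -big_seq_cond (perm_big (s j)) /=; last first.
    apply: uniq_perm; rewrite ?fset_uniq ?filter_uniq ?iota_uniq // => i.
    by rewrite in_fset.
  rewrite big_filter big_mkcond /lin.
  rewrite -(big_mkord xpredT (fun i => (r j)`_i *: G i)) /index_iota subn0.
  by apply: eq_bigr => i _; case: eqVneq => //= ->; rewrite scale0r.
exists F, c; split=> // V x; split.
- split=> [k l kl i j|k]; last by rewrite sumF.
  rewrite !FE => /hr/andP[_ h1] /hr/andP[h2 _].
  exact: leq_trans h1 (leq_trans (incr_le hm kl) h2).
- by move=> k i /[dup] /cE->; rewrite FE => _; exact: (cr k).1.
- move=> k; have := sumF R^o (fun=> 1) k; rewrite lin_const (cr k).2 scale1r => <-.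
  by apply: eq_bigr => i _; rewrite -[RHS]/(c i * 1) mulr1.
Qed.

Lemma convex_block_seqI (V : lmodType R) (x : nat -> V) m r : iblock m r ->
  (forall j, convex_poly (r j)) -> convex_block_seq x (fun j => lin x (r j)).
Proof. by move=> hr cr; have [F [c [h _ _]]] := iblock_fset hr cr; exists F, c. Qed.

Lemma averages_block_seqI (V : lmodType R) (x : nat -> V) m r : iblock m r ->
  (forall j, convex_poly (r j)) ->
  (forall j, exists c, forall i, (r j)`_i != 0 -> (r j)`_i = c) ->
  averages_block_seq x (fun j => lin x (r j)).
Proof.
move=> hr cr ar; have [F [c [h FE cE]]] := iblock_fset hr cr.
exists F, c; split=> // k i iF.
have [_ _ c1] := h R^o (fun=> 0); have [b hb] := ar k.
have cb l : l \in F k -> c l = b by move=> lF; rewrite (cE k) // hb // -FE.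
have F1 : #|` F k|%:R * b = 1.
  rewrite -[RHS](c1 k) big_seq_cond (eq_bigr (fun=> b)) => [|l /andP[/cb]//].
  by rewrite -big_seq_cond big_const_seq count_predT iter_addr addr0 mulr_natl.
have F0 : #|` F k|%:R != 0 :> R.
  by apply/eqP => F0; move: F1; rewrite F0 mul0r => /esym/eqP; rewrite oner_eq0.
by rewrite (cb _ iF); apply: (mulfI F0); rewrite F1 divff.
Qed.

End Spaces.

(** * Transfer from [nu] to the norm of [X] *)

Section Assembly.
Variables (R : realType) (X : completeNormedModType R) (e : nat -> X).
Variables (Z : completeNormedModType R) (z : nat -> Z) (nu : X -> R).
Hypotheses (nu_norm : equivalent_norm nu) (nu_spr : one_spreading nu e).
Hypothesis zlim : forall (n : nat) (a : nat -> R),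
  (fun N => nu (lincomb (interval_average e N) n a)) @ \oo --> (`|lincomb z n a| : R).

Let nuS : seminorm nu.
Proof. by case: nu_norm => -[]. Qed.

Lemma comparable_nu (q : nat -> {poly R}) (N : {poly R} -> R) :
  comparable_norms (fun p => nu (lin e (lin q p))) N ->
  comparable_norms (fun p => `|lin (lin e \o q) p|) N.
Proof.
have [_ [a [b [a0 b0 hab]]]] := nu_norm.
move=> [c [C [c0 C0 h]]]; exists (c * a), (C * b); split; rewrite ?mulr_gt0 // => p.
have := hab (lin e (lin q p)); have := h p; rewrite lin_comp => /andP[h1 h2] /andP[h3 h4].
apply/andP; split; rewrite -mulrA.
  by apply: le_trans h1; rewrite ler_pM2l.
by apply: le_trans h2 _; rewrite ler_pM2l.
Qed.

Lemma suppression_nu (q : nat -> {poly R}) (x : nat -> X) K :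
  (forall k, x k = lin e (q k)) -> (forall k, x k != 0) ->
  (forall p (A : pred nat), nu (lin e (lin q (coefmul (fun i => (A i)%:R) p))) <=
    K * nu (lin e (lin q p))) -> unconditional_seq x.
Proof.
have [_ [a [b [a0 b0 hab]]]] := nu_norm.
move=> xq x0 h.
have xE p : lin x p = lin e (lin q p).
  by rewrite lin_comp; apply: eq_lin => k _; rewrite xq.
apply: (@unconditional_of_suppression _ _ _ (a^-1 * (`|K| * b))) => // p A.
rewrite -mulrA mulrC ler_pdivlMr // mulrC !xE.
have /andP[h1 _] := hab (lin e (lin q (coefmul (fun i => (A i)%:R) p))).
have /andP[_ h2] := hab (lin e (lin q p)).
apply: le_trans h1 _; apply: le_trans (h p A) _.
rewrite -mulrA; apply: le_trans (_ : `|K| * nu (lin e (lin q p)) <= _).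
  by rewrite ler_wpM2r ?ler_norm // (sn_ge0 nuS).
by rewrite ler_wpM2l.
Qed.

Hypothesis he : conditional_spreading_basis e.

(** Otherwise 0 has two expansions, differing in the i-th coefficient. *)
Lemma basis_neq0 i : e i != 0.
Proof.
have [[_ he'] _ _] := he; apply/eqP => ei0.
have [a [_ ua]] := he' 0 I.
have exp0 (b : nat -> R) : (forall j, j != i -> b j = 0) -> is_expansion e b 0.
  move=> hb; rewrite /is_expansion.
  have -> : series (fun j => b j *: e j) = cst 0; last exact: cvg_cst.
  apply/funext => n; rewrite /series /= big1 // => j _.
  by have [->|/hb->] := eqVneq j i; rewrite ?ei0 ?scaler0 ?scale0r.
have h1 := ua _ (exp0 (fun=> 0) (fun _ _ => erefl)).
have h2 := ua _ (exp0 (fun j => (j == i)%:R) _).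
have : (0 : R) = 1; last by move/eqP; rewrite eq_sym oner_eq0.
transitivity (a i); first by rewrite h1.
by rewrite h2 ?eqxx // => j /negbTE->.
Qed.

Lemma basis_geometry : geometry (fun p => nu (lin e p))
  (fun p => nu (lin (fun i => e i.*2 - e i.*2.+1) p)) (fun p => `|lin z p|).
Proof.
have [basis _ ncond] := he.
have cond : ~ exists K : R, forall p (A : pred nat),
    nu (lin e (coefmul (fun i => (A i)%:R) p)) <= K * nu (lin e p).
  move=> [K hK]; apply: ncond.
  apply: (@suppression_nu (fun k => 'X^k) _ K); first by move=> k; rewrite linX.
    exact: basis_neq0.
  by move=> p A; rewrite !lin_id.
have [_ [a [b [a0 b0 hab]]]] := nu_norm.
split.
- exact: (E_seminorm e nuS).
- exact: (D_seminorm e nuS).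
- exact: (Z_seminorm z).
- exact: (D_le_2E nuS nu_spr).
- exact: (Z_le_E nuS nu_spr zlim).
- exact: (E_le_DZ nuS nu_spr zlim).
- exact: (D_spread nu_spr).
- exact: (D_coefmul nuS nu_spr).
- exact: (Z_merge nuS nu_spr zlim).
- exact: (D_average_small nuS nu_spr cond).
- exact: (D_small_coefs nuS nu_spr).
- exact: (Z_coef nuS nu_spr a0 b0 hab zlim basis cond).
Qed.

(** The projection is bounded because merging along [owner] does not increase the norm of [z],
    itself dominated by [nu]. *)
Lemma convex_block_complemented x : convex_block_seq e x -> equivalent_seq x z ->
  complemented (closed_span x).
Proof.
have [basis _ _] := he; have G := basis_geometry.
have [_ [a [b [a0 b0 hab]]]] := nu_norm.
move=> /convex_block_seqE[n [q [hq cq xq]]] /equivalent_seqP[c [C [c0 C0 h]]].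
have [k [nk _ k2]] := owner hq.1.
apply: (@complemented_closed_span _ _ e x k q (c^-1 * b)).
- exact: closed_span_basis.
- by rewrite mulr_ge0 ?invr_ge0 // ltW.
- move=> p; rewrite -lin_collapse -mulrA mulrC ler_pdivlMr // mulrC.
  have /andP[h1 _] := h (collapse k p); apply: le_trans h1 _.
  apply: le_trans (geoZ_merge G p nk) _; apply: le_trans (geoZE G p) _.
  by case/andP: (hab (lin e p)).
- exact: xq.
- by move=> j i /hq.2/k2.
- by move=> j; exact: (cq j).2.
Qed.

Lemma averages_equivalent : exists x, averages_block_seq e x /\ equivalent_seq x z.
Proof.
have [m [r [hr cr ar hc]]] := average_blocks basis_geometry
  (iblock_X R (fun i => ltnSn i)) (fun k => convex_X R k).
exists (fun j => lin e (r j)); split; first exact: averages_block_seqI hr cr ar.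
apply/equivalent_seqP; apply: (comparable_nu (q := r)).
have rE : (fun j => lin (fun k => 'X^k) (r j)) = r by apply/funext => j; rewrite lin_id.
by rewrite rE in hc.
Qed.

Lemma comparable_trans (N1 N2 N3 : {poly R} -> R) :
  comparable_norms N1 N2 -> comparable_norms N2 N3 -> comparable_norms N1 N3.
Proof.
move=> [c [C [c0 C0 h]]] [c' [C' [c'0 C'0 h']]].
exists (c' * c), (C' * C); split; rewrite ?mulr_gt0 // => p.
have /andP[h1 h2] := h p; have /andP[h3 h4] := h' p.
apply/andP; split; rewrite -mulrA.
  by apply: le_trans h3; rewrite ler_pM2l.
by apply: le_trans h4 _; rewrite ler_pM2l.
Qed.

Lemma convex_block_subsequence x : convex_block_seq e x ->
  exists f : nat -> nat, increasing_seq f /\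
    (equivalent_seq (x \o f) e \/ equivalent_seq (x \o f) z).
Proof.
move=> /convex_block_seqE[n [q [hq cq xq]]].
have [f [hf hc]] := convex_subsequence basis_geometry hq cq.
have xf : x \o f = lin e \o (q \o f) by apply/funext => k /=; rewrite xq.
exists f; split; first exact/increasing_seqP.
case: hc => /comparable_nu hc; [left|right]; apply/equivalent_seqP; rewrite xf //.
apply: comparable_trans hc _.
have [_ [a [b [a0 b0 hab]]]] := nu_norm.
exists b^-1, a^-1; split; rewrite ?invr_gt0 // => p.
have /andP[h1 h2] := hab (lin e p).
by rewrite [b^-1 * _]mulrC ler_pdivrMr // [a^-1 * _]mulrC ler_pdivlMr // !(mulrC `|lin e p|) h1 h2.
Qed.

Lemma convex_block_further (x : nat -> X) q m r : (forall k, x k = lin e (q k)) ->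
  iblock m r -> (forall j, convex_poly (r j)) ->
  comparable_norms (fun p => nu (lin e (lin (fun j => lin q (r j)) p))) (fun p => `|lin z p|) ->
  exists y, convex_block_seq x y /\ equivalent_seq y z.
Proof.
move=> xq hr cr /comparable_nu hc.
exists (fun j => lin x (r j)); split; first exact: convex_block_seqI hr cr.
apply/equivalent_seqP; suff -> : (fun j => lin x (r j)) = lin e \o (fun j => lin q (r j)) by [].
by apply/funext => j /=; rewrite lin_comp; apply: eq_lin => k _; rewrite xq.
Qed.

Lemma convex_block_averages (x : nat -> X) : convex_block_seq e x ->
  exists y, convex_block_seq x y /\ equivalent_seq y z.
Proof.
move=> /convex_block_seqE[n [q [hq cq xq]]].
have [m [r [hr cr _ hc]]] := average_blocks basis_geometry hq cq.
exact: convex_block_further xq hr cr hc.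
Qed.

Lemma block_unconditional_or_convex (x : nat -> X) : block_seq e x -> seminormalized x ->
  (exists f : nat -> nat, increasing_seq f /\ unconditional_seq (x \o f)) \/
  (exists y, convex_block_seq x y /\ equivalent_seq y z).
Proof.
move=> [F [c [sF xE]]] [m [M [m0 hmM]]].
have x0 k : x k != 0.
  by rewrite -normr_gt0 (lt_le_trans m0) //; case/andP: (hmM k).
have F0 k : F k != fset0.
  by apply/eqP => Fk; have := x0 k; rewrite xE Fk big_seq_fset0 eqxx.
have [n hq] := iblock_of_fset c sF F0.
set q := fun k => _ in hq.
have xq k : x k = lin e (q k) by rewrite xE lin_fset.
have [_ [a [b [a0 b0 hab]]]] := nu_norm.
have hE k : a * m <= nu (lin e (q k)) <= b * M.
  have /andP[h1 h2] := hab (x k); have /andP[h3 h4] := hmM k.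
  rewrite -xq; apply/andP; split.
    by apply: le_trans h1; rewrite ler_pM2l.
  by apply: le_trans h2 _; rewrite ler_pM2l.
have [[f [hf [K hK]]]|[l [r [hr cr hc]]]] :=
    block_dichotomy basis_geometry hq (mulr_gt0 a0 m0) hE.
  left; exists f; split; first exact/increasing_seqP.
  by apply: (@suppression_nu (q \o f) _ K) => [k|k|p A]; [exact: xq|exact: x0|exact: hK].
by right; exact: convex_block_further xq hr cr hc.
Qed.

End Assembly.

Theorem proposition5p1 (R : realType) (X : completeNormedModType R)
    (e : nat -> X) (he : conditional_spreading_basis e)
    (Z : completeNormedModType R) (z : nat -> Z)
    (hz : convex_block_homogeneous_part e z) :
  (* (i) *)
  (exists x : nat -> X, averages_block_seq e x /\ equivalent_seq x z) /\
  (* (ii) *)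
  ((forall x : nat -> X, convex_block_seq e x -> equivalent_seq x z ->
      complemented (closed_span x)) /\
   (exists Y : set X, complemented Y /\ isomorphic_to_subspace Z Y)) /\
  (* (iii) *)
  (forall x : nat -> X, convex_block_seq e x ->
     exists f : nat -> nat, increasing_seq f /\
       (equivalent_seq (x \o f) e \/ equivalent_seq (x \o f) z)) /\
  (* (iv) *)
  (forall x : nat -> X, convex_block_seq e x ->
     exists y : nat -> X, convex_block_seq x y /\ equivalent_seq y z) /\
  (* (v) *)
  (forall x : nat -> X, block_seq e x -> seminormalized x ->
     (exists f : nat -> nat, increasing_seq f /\ unconditional_seq (x \o f)) \/
     (exists y : nat -> X, convex_block_seq x y /\ equivalent_seq y z)).

Proof.
case: hz => dense [nu [nu_norm nu_spr zlim _]].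
have [x [ax xz]] := averages_equivalent nu_norm nu_spr zlim he.
have cx : convex_block_seq e x by case: ax => F [c [h _]]; exists F, c.
split; first by exists x.
split.
  split; first exact: (convex_block_complemented nu_norm nu_spr zlim he).
  (* The averages of the first assertion span the complemented copy of [Z]. *)
  exists (closed_span x); split; last exact: (isomorphic_closed_span dense xz).
  exact: (convex_block_complemented nu_norm nu_spr zlim he cx xz).
split; first exact: (convex_block_subsequence nu_norm nu_spr zlim he).
split; first exact: (convex_block_averages nu_norm nu_spr zlim he).
exact: (block_unconditional_or_convex nu_norm nu_spr zlim he).
Qed.
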